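(* Let $n\ge 1$, $R>0$, $p>1$, and let $B_R\subset\mathbb{R}^n$ be the ball of radius $R$ centered at the origin. Let $u_0:\overline{B}_R\to\mathbb{R}$ be smooth, not identically zero, nonnegative, radially symmetric, nonincreasing as a function of $r=|x|$, vanishing on $\partial B_R$, and such that $$\Delta u_0(x)+e^{u_0(x)^p}\ge 0,\qquad x\in B_R .$$ Let $u$ be a classical solution of $$u_t=\Delta u+e^{u^p}\ \text{ in } B_R\times(0,T),\qquad u=0\ \text{ on } \partial B_R\times(0,T),\qquad u(x,0)=u_0(x)\ \text{ for } x\in B_R,$$ which blows up at the finite time $T$ and whose only blow-up point is $x=0$. Then there exists a constant $C>0$ such that $$u(0,t)\le \log C-\frac1p\log(T-t),\qquad t\in(0,T).$$
   Context: A (nonnegative) classical solution is one that is continuous on $\overline{B}_R\times[0,T)$, is $C^{2}$ in $x$ and $C^1$ in $t$ for $0<t<T$, and satisfies the problem pointwise. The solution blows up at the finite time $T$ if it is a classical solution on $[0,T)$, $0<T<\infty$, and $\max_{\overline{B}_R}u(\cdot,t)\to\infty$ as $t\to T^-$. A point $x_0\in\overline{B}_R$ is a blow-up point if there are sequences $x_k\in \overline{B}_R$, $t_k\in(0,T)$ with $x_k\to x_0$, $t_k\to T$ and $u(x_k,t_k)\to\infty$. *)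

(* Defs.v *)
From HB Require Import structures.
From mathcomp Require Import all_boot all_order all_algebra.
From mathcomp Require Import all_classical all_reals all_analysis.

Set Implicit Arguments.
Unset Strict Implicit.
Unset Printing Implicit Defensive.

Import Order.TTheory GRing.Theory Num.Theory.
Import numFieldNormedType.Exports.

Local Open Scope classical_set_scope.
Local Open Scope ring_scope.

Section Defs.
Context {R : realType} {n : nat}.
Implicit Types (D : set 'rV[R]_n) (f : 'rV[R]_n -> R) (u : 'rV[R]_n -> R -> R).

(* The library norm on 'rV[R]_n is the sup norm (it induces the same topology),
   so Euclidean balls are defined from the Euclidean norm below. *)
Definition enorm (x : 'rV[R]_n) : R := Num.sqrt (\sum_(i < n) x 0 i ^+ 2).

Definition eball (r : R) : set 'rV[R]_n := [set x | enorm x < r].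

Definition ecball (r : R) : set 'rV[R]_n := [set x | enorm x <= r].

Definition esphere (r : R) : set 'rV[R]_n := [set x | enorm x = r].

Definition partial (i : 'I_n) f : 'rV[R]_n -> R := 'D_(delta_mx 0 i) f.

Definition laplacian f (x : 'rV[R]_n) : R :=
  \sum_(i < n) partial i (partial i f) x.

(* f is C^k on D; meant for open D, since 'D_v is a two-sided derivative. *)
Fixpoint Ck (k : nat) D f : Prop :=
  (forall x, D x -> {for x, continuous f}) /\
  match k with
  | 0 => True
  | k'.+1 => forall i : 'I_n,
      (forall x, D x -> derivable f x (delta_mx 0 i)) /\ Ck k' D (partial i f)
  end.

(* Smoothness on a set that need not be open: f is the restriction to D of a
   C^oo function on the whole space. *)
Definition smooth_on D f : Prop :=
  exists g : 'rV[R]_n -> R,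
    (forall k : nat, Ck k setT g) /\ (forall x, D x -> g x = f x).

Definition radially_symmetric D f : Prop :=
  forall x y, D x -> D y -> enorm x = enorm y -> f x = f y.

Definition radially_nonincreasing D f : Prop :=
  forall x y, D x -> D y -> enorm x <= enorm y -> f y <= f x.

Definition C1_itv (a b : R) (g : R -> R) : Prop :=
  forall t, a < t < b -> derivable g t 1 /\ {for t, continuous (derive1 g)}.

(* Nonnegative classical solution on [0, T) of u_t = laplacian u + e^(u^p) in
   the ball of radius r, with zero boundary data and initial datum u0.  Since
   u >= 0 and p > 1, the library's powR is the usual real power. *)
Record classical_solution (r p T : R) (u0 : 'rV[R]_n -> R) u : Prop := {
  cs_ge0 : forall x t, ecball r x -> 0 <= t < T -> 0 <= u x t ;
  cs_continuous : {within ecball r `*` [set t : R | 0 <= t < T],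
    continuous (fun z : 'rV[R]_n * R => u z.1 z.2)} ;
  cs_C2 : forall t, 0 < t < T -> Ck 2 (eball r) (fun x => u x t) ;
  cs_C1 : forall x, eball r x -> C1_itv 0 T (u x) ;
  cs_eq : forall x t, eball r x -> 0 < t < T ->
    derive1 (u x) t = laplacian (fun y => u y t) x + expR (u x t `^ p) ;
  cs_boundary : forall x t, esphere r x -> 0 < t < T -> u x t = 0 ;
  cs_initial : forall x, eball r x -> u x 0 = u0 x
}.

(* For a classical solution the sup below is a maximum, since u(., t) is
   continuous on the compact closed ball. *)
Definition blows_up_at (r T : R) u : Prop :=
  sup [set u x t | x in ecball r] @[t --> T^'-] --> +oo.

Definition blow_up_point (r T : R) u (x0 : 'rV[R]_n) : Prop :=
  ecball r x0 /\
  exists (x_ : nat -> 'rV[R]_n) (t_ : nat -> R),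
    [/\ forall k, ecball r (x_ k) /\ 0 < t_ k < T,
        x_ @ \oo --> x0,
        t_ @ \oo --> T
      & u (x_ k) (t_ k) @[k --> \oo] --> +oo].

End Defs.

(* Main.v *)
Require Import Defs.
From mathcomp Require Import all_boot all_order all_algebra.
From mathcomp Require Import all_classical all_reals all_analysis.
From mathcomp Require Import ring lra.
Set Implicit Arguments.
Unset Strict Implicit.
Unset Printing Implicit Defensive.
Import Order.TTheory GRing.Theory Num.Theory.
Import numFieldNormedType.Exports.
Local Open Scope classical_set_scope.
Local Open Scope ring_scope.

(** Write f(v) for the reaction exp(v^p).  Since v^p >= p v + 1 - p, the bound
is much weaker than the rate suggested by the equation v' = f(v), and it follows
from the differential inequality
[[
    M'(t) >= delta exp(p M(t)),     M(t) = u(0,t),     T/2 <= t < T,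
]]
which makes exp(-p M(t)) + p delta t nonincreasing, so that
p delta (T - t) <= exp(-p M(t)) ([blow_up_rate]).  The method is that of Friedman
and McLeod: one compares u_t with a convex function of u.  A classical solution
need not have a derivative u_t to which the equation can be applied, so u_t is
replaced throughout by the increments z(x,t) = u(x,t+h) - u(x,t), with constants
that do not depend on h.  All the comparisons are instances of one minimum
principle for continuous functions on a compact set of space-time
([parabolic_minimum_principle]), used on tubes: balls of fixed radius whose
centre may move with time.

The argument has four steps.

- u is nondecreasing in time.  The initial datum is a subsolution, so u(.,t) stays
  above it, and hence u(.,t+h) >= u(.,t) ([sol_nondecreasing]).

- z >= c h near the origin for T/2 <= t, with c independent of h
  ([increment_lower_bound]).  The initial datum is not stationary, for otherwise u
  would stay below it and remain bounded; so Laplacian + reaction is at least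
  k > 0 on a small ball around some x0, and there u - u0 grows at least linearly in
  time, by comparison with a paraboloid ([initial_growth]).  The increment z is
  a nonnegative supersolution of the heat equation, so this gain can be carried
  to the origin by an explicit subsolution: the bump
  exp(-A t) (S - |x - y(t)|^2)^2 supported in a ball whose centre y(t) moves from
  x0 to 0.

- u is bounded by some K on a small sphere around the origin, up to time T,
  because the origin is the only blow-up point ([sphere_bound]).

- z >= delta h exp(p u) in the small ball ([increment_ge_expR]).  Where u <= K this
  is the second step, for delta = c exp(-p K).  Where u > K >= 1, the
  function w = u + delta h exp(p u) is a subsolution, because exp(p .) is convex
  and f(w) - f(u) >= p f(u) (w - u) for w >= u >= 1 ([reaction_growth]); so the
  minimum principle applies to u(x,t+h) - w(x,t).

Dividing by h at x = 0 gives the differential inequality. *)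

(** * Derivatives in one real variable and along a line *)

Section Directional.
Context {R : realType} {V : normedModType R}.
Implicit Types (f : V -> R) (x v : V).

Lemma difference_quotient_line f x v (s : R) :
  (fun h => h^-1 *: (((fun h : R => f (h *: v + x)) \o shift s) (h *: 1)
     - f (s *: v + x))) =
  (fun h => h^-1 *: ((f \o shift (s *: v + x)) (h *: v) - f (s *: v + x))).
Proof. by apply/funext => h /=; rewrite scalerDl addrA [h%:A]mulr1. Qed.

Lemma derivable_line f x v (s : R) :
  derivable (fun h : R => f (h *: v + x)) s 1 = derivable f (s *: v + x) v.
Proof. by rewrite /derivable difference_quotient_line. Qed.

Lemma derive1_line f x v (s : R) :
  derive1 (fun h : R => f (h *: v + x)) s = 'D_v f (s *: v + x).
Proof. by rewrite derive1E /derive difference_quotient_line. Qed.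

Lemma is_derive_line f x v (df : R) :
  is_derive (0 : R) 1 (fun h : R => f (h *: v + x)) df -> is_derive x v f df.
Proof.
have g0 : 0 *: v + x = x :> V by rewrite scale0r add0r.
by case; rewrite derivable_line -derive1E derive1_line g0 => ? ?; split.
Qed.

Lemma near_line x v (P : V -> Prop) :
  (\forall y \near x, P y) -> \forall s \near (0 : R), P (s *: v + x).
Proof.
have : (fun s : R => s *: v + x) @ (0 : R) --> x.
  rewrite -[X in _ --> X]add0r -[X in X + _ ](scale0r v).
  by apply: cvgD; [apply: cvgZr_tmp|apply: cvg_cst].
by move=> + P1; exact.
Qed.

Lemma is_derive_comp_dir (F : R -> R) f x v (dF df : R) :
  is_derive (f x) 1 F dF -> is_derive x v f df ->
  is_derive x v (F \o f) (dF * df).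
Proof.
move=> HF [f1 f2].
have g0 : 0 *: v + x = x :> V by rewrite scale0r add0r.
have HF' : is_derive ((fun h : R => f (h *: v + x)) 0) 1 F dF by rewrite g0.
have Hg : is_derive (0 : R) 1 (fun h : R => f (h *: v + x)) df.
  split; first by rewrite derivable_line g0.
  by rewrite -derive1E derive1_line g0.
have [c1 c2] := @is_derive1_comp _ _ _ _ _ _ HF' Hg.
split.
  by have := derivable_line (F \o f) x v 0; rewrite g0 => <-.
by have := derive1_line (F \o f) x v 0; rewrite g0 => <-; rewrite derive1E c2 mulrC.
Qed.

(** If the second derivative were negative, the first one, which vanishes at the
minimum, would be negative just to the right of it, and the mean value theorem
would give a smaller value there. *)
Lemma derive1_second_derivative_test (f : R -> R) (x : R) :
  (\forall y \near x, derivable f y 1) -> (\forall y \near x, f x <= f y) ->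
  derivable (derive1 f) x 1 -> 0 <= derive1 (derive1 f) x.
Proof.
move=> df fmin d2; rewrite leNgt; apply/negP => f2.
have [e /= e0 He] : \forall y \near x, derivable f y 1 /\ f x <= f y.
  by near=> y; split; near: y.
have Hd y : x - e < y < x + e -> derivable f y 1.
  by move=> ?; apply He => /=; rewrite ltr_norml; apply/andP; split; lra.
have Hm y : x - e < y < x + e -> f x <= f y.
  by move=> ?; apply He => /=; rewrite ltr_norml; apply/andP; split; lra.
have f'0 : derive1 f x = 0.
  rewrite derive1E; apply: derive_val.
  apply: (@derive1_at_min _ f (x - e) (x + e)) => [|t||t].
  - lra.
  - by rewrite in_itv/=; exact: Hd.
  - by rewrite in_itv/=; lra.
  - by rewrite in_itv/=; exact: Hm.
have : \forall h \near 0^',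
    h^-1 *: ((derive1 f \o shift x) (h *: 1) - derive1 f x) < 0.
  move: d2 f2; rewrite [in X in _ -> X -> _]derive1E => d2 f2.
  have := cvgr_lt _ d2 _ f2.
  by apply.
rewrite near_withinE => -[h /= h0 Hh].
have H y : x < y < x + h -> derive1 f y < 0.
  move=> xy; have y0 : 0 < y - x by lra.
  have := Hh (y - x); rewrite /= sub0r normrN gtr0_norm // => /(_ _ _).
  rewrite f'0 subr0 [_%:A]mulr1 subrK /GRing.scale/= pmulr_rlt0 ?invr_gt0//.
  apply; first by lra.
  by rewrite gt_eqF.
pose m := Num.min e h / 2.
have m0 : 0 < m by rewrite divr_gt0 // lt_min e0.
have me : m < e /\ m < h.
  by rewrite /m; case: (ltP e h); lra.
have [|t|c|c] := @MVT _ f (derive1 f) x (x + m) _ _ _; first lra.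
- rewrite in_itv/= => xt; rewrite derive1E; apply/derivableP/Hd; lra.
- apply: derivable_within_continuous => y; rewrite in_itv/= => xy; apply: Hd; lra.
rewrite in_itv/= => xc; have : f x <= f (x + m) by apply: Hm; lra.
have : derive1 f c < 0 by apply: H; lra.
by rewrite addrAC subrr add0r => ? ? E; have : derive1 f c * m < 0; [rewrite nmulr_rlt0|lra].
Unshelve. all: by end_near. Qed.

Lemma second_derivative_test f x v :
  (\forall y \near x, derivable f y v) -> (\forall y \near x, f x <= f y) ->
  derivable ('D_v f) x v -> 0 <= 'D_v ('D_v f) x.
Proof.
move=> df fmin d2.
pose g (h : R) := f (h *: v + x).
have g' : derive1 g = fun h => 'D_v f (h *: v + x).
  by apply/funext => h; rewrite derive1_line.
have g0 : 0 *: v + x = x :> V by rewrite scale0r add0r.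
have := @derive1_second_derivative_test g 0.
rewrite g' (derive1_line ('D_v f)) g0; apply.
- have := near_line v df; apply: filterS => s.
  by rewrite -derivable_line.
- by have := near_line v fmin; apply: filterS => s; rewrite /g g0.
- by rewrite (derivable_line ('D_v f)) g0.
Qed.

(** Only the values to the left of [t] are available at the final time of a
space-time domain, hence the one-sided form. *)
Lemma derive_le0_left_min (g : R -> R) (t dg : R) :
  is_derive t 1 g dg -> (\forall s \near t^'-, g t <= g s) -> dg <= 0.
Proof.
move=> [dgt <-] gmin; rewrite leNgt; apply/negP => dg0.
have : \forall h \near 0^', 0 < h^-1 *: ((g \o shift t) (h *: 1) - g t).
  by have := cvgr_gt _ dgt _ dg0; apply.
rewrite near_withinE => -[e /= e0 He].
move: gmin; rewrite near_withinE => -[e' /= e'0 He'].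
pose m := Num.min e e' / 2.
have m0 : 0 < m by rewrite divr_gt0 // lt_min e0.
have me : m < e /\ m < e'.
  by rewrite /m; case: (ltP e e'); lra.
have := He (- m); rewrite /= sub0r opprK gtr0_norm // => /(_ (proj1 me)).
have := He' (t - m); rewrite /= opprB addrCA subrr addr0 gtr0_norm//.
move=> /(_ (proj2 me)); rewrite ltrBlDr ltrDl => /(_ m0) gm.
rewrite oppr_eq0 gt_eqF// => /(_ isT).
rewrite [_%:A]mulr1 addrC /GRing.scale/= invrN mulNr oppr_gt0.
by rewrite pmulr_rlt0 ?invr_gt0// [- m + t]addrC; lra.
Qed.

(** The reflection [s |-> 2 t - s] turns the increments after [t] into values to the
left of [t]. *)
Lemma derive_ge_increment (M : R -> R) (t dM c : R) :
  is_derive t 1 M dM -> (\forall s \near t^'-, M t + c * (t - s) <= M (t + (t - s))) ->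
  c <= dM.
Proof.
move=> dMt hM.
(* Change of variable s |-> 2 t - s. *)
have dr : is_derive t 1 (cst (2 * t) - id : R -> R) (-1 : R).
  by apply: is_derive_eq; rewrite add0r.
have t2 : (cst (2 * t) - id : R -> R) t = t by change (2 * t - t = t); ring.
have dM' : is_derive ((cst (2 * t) - id : R -> R) t) 1 M dM by rewrite t2.
have d1 := is_derive1_comp dM' dr.
have : dM * -1 - c * (-1) <= 0.
  apply: (@derive_le0_left_min ((M \o (cst (2 * t) - id)) - c \*: (cst (2 * t) - id)) t).
  apply: filterS hM => s.
  change (M t + c * (t - s) <= M (t + (t - s)) ->
   M (2 * t - t) - c * (2 * t - t) <= M (2 * t - s) - c * (2 * t - s)).
  have -> : 2 * t - t = t by ring.
  have -> : 2 * t - s = t + (t - s) by ring.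
  by move: (M (t + _)) (M t) => a b; lra.
lra.
Qed.

End Directional.

(** * Laplacians and the parabolic minimum principle *)

Section SpaceTimeCalculus.
Context {R : realType}.

Context {n : nat}.
Implicit Types (f g : 'rV[R]_n -> R) (x y : 'rV[R]_n) (i j : 'I_n).
Local Notation e_ i := (delta_mx 0 i : 'rV[R]_n).

(** The partial derivatives have to exist near [x], and not only at [x], for the
second ones to be computed from them. *)
Definition twice_derivable f x := forall i,
  (\forall y \near x, derivable f y (e_ i)) /\
  derivable (partial i f) x (e_ i).

(** [laplacian f x] is a total expression, meaningless where the partial derivatives
do not exist; the algebraic rules below need their existence as well as the value. *)
Definition is_laplacian f x (l : R) := twice_derivable f x /\ laplacian f x = l.

(** The introduction rule: it is enough to exhibit the first partial derivatives near
[x] and the second ones at [x]. *)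
Lemma is_laplacian_partials f x (f1 : 'I_n -> 'rV[R]_n -> R) (f2 : 'I_n -> R) :
  (forall i, \forall y \near x, is_derive y (e_ i) f (f1 i y)) ->
  (forall i, is_derive x (e_ i) (f1 i) (f2 i)) ->
  is_laplacian f x (\sum_i f2 i).
Proof.
move=> h1 h2.
have h i : {near x, f1 i =1 partial i f}.
  by have := h1 i; apply: filterS => y [_ <-].
have h3 i : is_derive x (e_ i) (partial i f) (f2 i).
  exact: near_eq_is_derive (h i) (h2 i).
split; first by move=> i; split;
  [have := h1 i; apply: filterS => y []|case: (h3 i)].
by apply: eq_bigr => i _; case: (h3 i).
Qed.

Lemma is_laplacian_ext f g x l : {near x, f =1 g} -> is_laplacian f x l ->
  is_laplacian g x l.
Proof.
move=> fg [tf <-]; apply: is_laplacian_partials => i.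
- have := (tf i).1; have := near_join fg.
  apply: filterS2 => y fgy dy; apply: (near_eq_is_derive fgy).
  exact: derivableP.
- by apply/derivableP; exact: (tf i).2.
Qed.

Lemma is_laplacianB f g x lf lg : is_laplacian f x lf -> is_laplacian g x lg ->
  is_laplacian (fun y => f y - g y) x (lf - lg).
Proof.
move=> [tf <-] [tg <-]; rewrite /laplacian -sumrB.
apply: (@is_laplacian_partials _ _ (fun i y => partial i f y - partial i g y)) => i.
- have := (tg i).1; have := (tf i).1; apply: filterS2 => y df dg.
  by apply: is_deriveB; exact/derivableP.
- by apply: is_deriveB; apply/derivableP; [exact: (tf i).2|exact: (tg i).2].
Qed.

Lemma is_laplacianZ k f x lf : is_laplacian f x lf ->
  is_laplacian (fun y => k * f y) x (k * lf).
Proof.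
move=> [tf <-]; rewrite /laplacian mulr_sumr.
apply: (@is_laplacian_partials _ _ (fun i y => k * partial i f y)) => i.
- have := (tf i).1; apply: filterS => y df.
  by apply: is_deriveZ; exact/derivableP.
- by apply: is_deriveZ; apply/derivableP; exact: (tf i).2.
Qed.

Lemma is_laplacian_cst k x : is_laplacian (fun=> k) x 0.
Proof.
have := @is_laplacian_partials (fun=> k) x (fun _ _ => 0) (fun=> 0).
rewrite big1//; apply => i.
by apply: filterE => y; exact: (is_derive_cst (k : R)).
Qed.

(** The chain rule, Lap F(f) = F'(f) Lap f + F''(f) |grad f|^2. *)
Lemma is_laplacian_comp (F F1 F2 : R -> R) f x l :
  (forall a : R, is_derive a 1 F (F1 a)) ->
  (forall a : R, is_derive a 1 F1 (F2 a)) ->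
  is_laplacian f x l ->
  is_laplacian (fun y => F (f y)) x
    (F1 (f x) * l + F2 (f x) * \sum_i partial i f x ^+ 2).
Proof.
move=> dF dF1 [tf <-]; rewrite /laplacian !mulr_sumr -big_split/=.
apply: (@is_laplacian_partials _ _ (fun i y => F1 (f y) * partial i f y)) => i.
- have := (tf i).1; apply: filterS => y df.
  exact: is_derive_comp_dir (dF _) (derivableP df).
- have d1 := is_derive_comp_dir (dF1 (f x)) (derivableP (nbhs_singleton (tf i).1)).
  apply: is_derive_eq; first by apply: is_deriveM d1 (derivableP (tf i).2).
  by rewrite /GRing.scale/=  /partial; ring.
Qed.

Lemma is_derive_coord x v j : is_derive x v (fun y => y 0 j) (v 0 j).
Proof.
apply: is_derive_line.
have -> : (fun h : R => (h *: v + x) 0 j) = v 0 j \*: id + cst (x 0 j).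
  by apply/funext => h; rewrite !mxE/= mulrC.
by apply: is_derive_eq; rewrite addr0 [LHS]mulr1.
Qed.

(** Squares of distances keep every barrier polynomial and avoid any use of the
Euclidean triangle inequality. *)
Definition sqdist x y : R := \sum_i (x 0 i - y 0 i) ^+ 2.

Lemma is_derive_sqdist c x v :
  is_derive x v (sqdist ^~ c) (\sum_i 2 * (x 0 i - c 0 i) * v 0 i).
Proof.
have -> : sqdist ^~ c =
    \sum_i ((fun y : 'rV[R]_n => y 0 i) - cst (c 0 i)) ^+ 2.
  by apply/funext => y; rewrite fct_sumE; apply: eq_bigr.
apply: is_derive_sum => i.
have := is_derive_coord x v i => ?.
by apply: is_derive_eq; rewrite subr0 expr1.
Qed.

Lemma sum_delta (F : 'I_n -> R) i : \sum_j F j * e_ i 0 j = F i.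
Proof.
rewrite (bigD1 i)//= big1 ?addr0 => [|j ji]; rewrite mxE eqxx.
  by rewrite eqxx mulr1.
by rewrite (negPf ji) mulr0.
Qed.

Lemma partial_sqdist c x i : partial i (sqdist ^~ c) x = 2 * (x 0 i - c 0 i).
Proof.
rewrite /partial; have [_ ->] := is_derive_sqdist c x (e_ i).
exact: sum_delta.
Qed.

Lemma is_laplacian_sqdist c x : is_laplacian (sqdist ^~ c) x (2 * n%:R).
Proof.
have -> : 2 * n%:R = \sum_(i < n) (2 : R).
  by rewrite sumr_const card_ord mulr_natr.
apply: (@is_laplacian_partials _ _ (fun i y => 2 * (y 0 i - c 0 i))) => i.
  apply: filterE => y; apply: is_derive_eq; first exact: is_derive_sqdist.
  exact: sum_delta.
have dc := is_derive_coord x (e_ i) i.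
have : is_derive x (e_ i) (2 \*: ((fun y : 'rV[R]_n => y 0 i) - cst (c 0 i))) 2.
  by apply: is_derive_eq; rewrite subr0 mxE !eqxx [LHS]mulr1.
by [].
Qed.

(** Take a minimum over [K] of exp(-(L+1)t) d, supposed negative. There the Laplacian
of [d] is nonnegative and, as [K] extends to the left in time, the time derivative
of the weighted function is nonpositive, that is d_t <= (L+1) d < L d; this
contradicts the differential inequality. The latter is only required where [d] is
negative, so that boundary values can be expressed by the absence of bad points. *)
Lemma parabolic_minimum_principle (K : set ('rV[R]_n * R))
    (d : 'rV[R]_n -> R -> R) (L : R) :
  compact K -> {within K, continuous (fun z => d z.1 z.2)} ->
  (forall x t, K (x, t) -> d x t < 0 ->
    [/\ \forall y \near x, K (y, t), \forall s \near t^'-, K (x, s) &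
    exists dt l, [/\ is_derive t 1 (d x) dt, is_laplacian (d ^~ t) x l &
      L * d x t <= dt - l]]) ->
  forall x t, K (x, t) -> 0 <= d x t.
Proof.
move=> cK cd sup x0 t0 K0; rewrite leNgt; apply/negP => d0.
pose w (s : R) := expR (- (L + 1) * s).
have wc : continuous w.
  by move=> s; apply: continuous_comp;
    [exact: mulrl_continuous|exact: continuous_expR].
have [||[x t]] := @compact_EVT_min _ _ (fun z => w z.2 * d z.1 z.2) _ _ cK _.
- by exists (x0, t0).
- move=> z; apply: cvgM; last exact: cd.
  apply: (@continuous_subspaceT _ _ _ (fun z : 'rV[R]_n * R => w z.2)) => {}z.
  by apply: continuous_comp; [exact: cvg_snd|exact: wc].
rewrite inE => Kxt min.
have {}min y s : K (y, s) -> w t * d x t <= w s * d y s.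
  by move=> Kys; apply: (min (y, s)); rewrite inE.
have w0 s : 0 < w s by exact: expR_gt0.
have dxt : d x t < 0.
  have := min _ _ K0; rewrite -(pmulr_rlt0 _ (w0 t)); move/le_lt_trans; apply.
  by rewrite pmulr_rlt0.
have [Ky Ks [dt [l [ddt [tl <-] Ldl]]]] := sup _ _ Kxt dxt.
have l0 : 0 <= laplacian (d ^~ t) x.
  apply: sumr_ge0 => i _; apply: second_derivative_test.
  - exact: (tl i).1.
  - apply: filterS Ky => y /min; by rewrite ler_pM2l.
  - exact: (tl i).2.
have dw : is_derive t 1 w (- (L + 1) * w t).
  have : is_derive t 1 (expR \o (- (L + 1) \*: id)) (expR (- (L + 1) * t) * (- (L + 1) * 1)).
    by apply: is_derive1_comp.
  by move=> ?; apply: is_derive_eq; rewrite mulr1 mulrC.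
have : w t *: dt + d x t *: (- (L + 1) * w t) <= 0.
  apply: (@derive_le0_left_min _ (w * d x) t).
  by apply: filterS Ks => s /min.
rewrite /GRing.scale/=.
have -> : w t * dt + d x t * (- (L + 1) * w t) = w t * (dt - (L + 1) * d x t).
  by ring.
rewrite pmulr_rle0//; lra.
Qed.

End SpaceTimeCalculus.

(** * The reaction term *)

Section Reaction.
Context {R : realType} (p : R) (hp : 1 < p).
Let p0 : 0 < p. Proof. exact: lt_trans ltr01 hp. Qed.

(** Young's inequality a * 1 <= a^p/p + 1/q with conjugate exponents. *)
Lemma bernoulli_powR (a : R) : 0 <= a -> 1 + p * (a - 1) <= a `^ p.
Proof.
move=> a0; pose q := (1 - p^-1)^-1.
have ip : p^-1 < 1 by rewrite invf_lt1.
have q0 : 0 < q by rewrite invr_gt0; lra.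
have := @conjugate_powR R a 1 p q a0 ler01 p0 q0.
rewrite invrK addrC subrK mulr1 => /(_ erefl).
rewrite powR1 mul1r => h.
have : p * a <= p * (a `^ p / p + (1 - p^-1)) by rewrite ler_pM2l.
have -> : p * (a `^ p / p + (1 - p^-1)) = a `^ p + p - 1.
  by field; rewrite gt_eqF.
by move=> ?; lra.
Qed.

(** The graph of a^p lies above its tangents: Bernoulli's inequality at b/a. *)
Lemma powR_tangent (a b : R) : 0 < a -> 0 <= b ->
  a `^ p + p * a `^ (p - 1) * (b - a) <= b `^ p.
Proof.
move=> a0 b0; have ba : 0 <= b / a by rewrite divr_ge0// ltW.
have -> : b `^ p = a `^ p * (b / a) `^ p.
  by rewrite -powRM ?(ltW a0)// mulrC divfK ?gt_eqF.
have -> : a `^ p + p * a `^ (p - 1) * (b - a) = a `^ p * (1 + p * (b / a - 1)).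
  by rewrite -(mulr_powRB1 (ltW a0) p0); field; rewrite gt_eqF.
by rewrite ler_pM2l ?powR_gt0//; exact: bernoulli_powR.
Qed.

Definition reaction (v : R) := expR (v `^ p).

Lemma reaction_gt0 v : 0 < reaction v.
Proof. exact: expR_gt0. Qed.

Lemma le_reaction v w : 0 <= v -> v <= w -> reaction v <= reaction w.
Proof.
move=> v0 vw; rewrite ler_expR.
by apply: ge0_ler_powR; rewrite ?nnegrE ?(ltW p0) ?(le_trans v0 vw).
Qed.

Lemma reaction_lipschitz (B : R) : exists L, 0 <= L /\ forall v w,
  0 <= v -> v <= w -> w <= B -> L * (v - w) <= reaction v - reaction w.
Proof.
have p1 : 1 < p := hp.
exists (reaction B * (p * B `^ (p - 1))); split.
  by rewrite !mulr_ge0 ?powR_ge0 ?ltW ?reaction_gt0.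
move=> v w v0; rewrite le_eqVlt => /predU1P[->|vw] wB; first lra.
have w0 : 0 < w by apply: le_lt_trans vw.
have h1 := powR_tangent w0 v0.
have h2 : expR (v `^ p) = expR (w `^ p) * expR (v `^ p - w `^ p).
  by rewrite -expRD addrC subrK.
have h3 := expR_ge1Dx (v `^ p - w `^ p).
have h4 : reaction w * (p * w `^ (p - 1) * (v - w)) <= reaction v - reaction w.
  rewrite {2}/reaction h2 -/(reaction w).
  have -> : reaction w * expR (v `^ p - w `^ p) - reaction w =
    reaction w * (expR (v `^ p - w `^ p) - 1) by ring.
  by rewrite ler_pM2l ?reaction_gt0//; lra.
apply: le_trans h4; rewrite [leRHS]mulrA ler_wnM2r ?subr_le0 ?(ltW vw)//.
apply: ler_pM.
- exact/ltW/reaction_gt0.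
- by rewrite mulr_ge0 ?powR_ge0// ltW.
- by apply: le_reaction => //; exact: ltW.
- rewrite ler_pM2l//; apply: ge0_ler_powR; rewrite ?nnegrE; lra.
Qed.

(** For v >= 1 the reaction f is convex with f' >= p f. This is the inequality
F' f <= f' F for F = exp(p .), on which the choice of F rests. *)
Lemma reaction_growth v w : 1 <= v -> v <= w ->
  p * reaction v * (w - v) <= reaction w - reaction v.
Proof.
have p1 : 1 < p := hp; move=> v1 vw.
have h1 := @powR_tangent v w ltac:(lra) ltac:(lra).
have h5 : 1 <= v `^ (p - 1).
  suff : 1 `^ (p - 1) <= v `^ (p - 1) by rewrite powR1.
  by apply: ge0_ler_powR; rewrite ?nnegrE; lra.
have h6 : p * (w - v) <= w `^ p - v `^ p.
  apply: le_trans (_ : p * v `^ (p - 1) * (w - v) <= _); last lra.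
  by rewrite ler_wpM2r ?subr_ge0// ler_peMr// ltW.
have h2 : expR (w `^ p) = expR (v `^ p) * expR (w `^ p - v `^ p).
  by rewrite -expRD addrC subrK.
have h3 := expR_ge1Dx (w `^ p - v `^ p).
rewrite {2}/reaction h2 -/(reaction v).
have -> : reaction v * expR (w `^ p - v `^ p) - reaction v =
  reaction v * (expR (w `^ p - v `^ p) - 1) by ring.
by rewrite mulrAC mulrC ler_pM2l ?reaction_gt0//; lra.
Qed.
End Reaction.

(** * Tubes in space-time *)

Section Tubes.
Context {R : realType} {n : nat}.
Implicit Types (f g : 'rV[R]_n -> R) (x : 'rV[R]_n) (y : R -> 'rV[R]_n).

Lemma continuous_sqdist {X : topologicalType} (a b : X -> 'rV[R]_n) :
  continuous a -> continuous b -> continuous (fun z => sqdist (a z) (b z)).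
Proof.
move=> ca cb.
have c1 i : continuous (fun z => a z 0 i - b z 0 i).
  move=> z; apply: cvgB; apply: (@continuous_comp _ _ _ _ (fun v : 'rV[R]_n => v 0 i)).
  - exact: ca.
  - exact: coord_continuous.
  - exact: cb.
  - exact: coord_continuous.
rewrite /sqdist; apply: continuous_big; first exact: add_continuous.
move=> i _; under eq_fun do rewrite expr2.
by move=> z; apply: cvgM; exact: c1.
Qed.

Lemma sqdistxx (x : 'rV[R]_n) : sqdist x x = 0.
Proof. by rewrite /sqdist big1// => i _; rewrite subrr expr0n. Qed.

Lemma sqdist_ge0 (x y : 'rV[R]_n) : 0 <= sqdist x y.
Proof. by apply: sumr_ge0 => i _; exact: sqr_ge0. Qed.

Lemma enormE x : enorm x = Num.sqrt (sqdist x 0).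
Proof. by congr Num.sqrt; apply: eq_bigr => i _; rewrite mxE subr0. Qed.

Lemma ecballE r x : 0 < r -> ecball r x <-> sqdist x 0 <= r ^+ 2.
Proof.
move=> r0; rewrite /ecball/= enormE -[X in _ <= X]ger0_norm ?(ltW r0)//.
by rewrite -sqrtr_sqr ler_sqrt// sqr_ge0.
Qed.

Lemma eballE r x : 0 < r -> eball r x <-> sqdist x 0 < r ^+ 2.
Proof.
move=> r0; rewrite /eball/= enormE -[X in _ < X]ger0_norm ?(ltW r0)//.
by rewrite -sqrtr_sqr ltr_sqrt// exprn_gt0.
Qed.

Lemma compact_ecball r : 0 < r -> compact (ecball r : set 'rV[R]_n).
Proof.
move=> r0; have -> : ecball r = [set x : 'rV[R]_n | sqdist x 0 <= r ^+ 2].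
  by apply/seteqP; split => x /ecballE; apply.
apply: bounded_closed_compact.
  exists r; split; first exact: num_real.
  move=> M rM x /= xr.
  rewrite [leLHS]/Num.norm/= mx_normrE; apply/bigmax_leP; split; first lra.
  move=> -[i j] _ /=; rewrite (ord1 i).
  apply: le_trans (ltW rM); rewrite -[leRHS](ger0_norm (ltW r0)) -ler_sqr ?nnegrE//.
  rewrite !real_normK ?num_real//.
  apply: le_trans xr; rewrite /sqdist (bigD1 j)//= mxE subr0 lerDl.
  by apply: sumr_ge0 => k _; exact: sqr_ge0.
apply: (@preimage_closed _ _ (sqdist ^~ 0) [set s | s <= r ^+ 2]); last first.
  exact: closed_le.
move=> x _; apply: continuous_sqdist; [move=> z; exact: cvg_id|exact: cst_continuous].
Qed.

Definition tube y (S a b : R) : set ('rV[R]_n * R) :=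
  [set z | a <= z.2 <= b /\ sqdist z.1 (y z.2) <= S].

Lemma compact_tube y S a b r : 0 < r -> continuous y ->
  (forall z, tube y S a b z -> ecball r z.1) -> compact (tube y S a b).
Proof.
move=> r0 cy sub.
apply: (@subclosed_compact _ _ (ecball r `*` `[a, b])) => //.
- have -> : tube y S a b = (snd @^-1` `[a, b]) `&`
     ((fun z : 'rV[R]_n * R => sqdist z.1 (y z.2)) @^-1` [set s | s <= S]).
    apply/seteqP; split => z; rewrite /tube/= in_itv//=.
  apply: closedI.
    apply: preimage_closed; last exact: interval_closed.
    by move=> z _; exact: cvg_snd.
  apply: preimage_closed; last exact: closed_le.
  move=> z _; apply: continuous_sqdist => {}z; first exact: cvg_fst.
  by apply: continuous_comp; [exact: cvg_snd|exact: cy].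
- by apply: compact_setX; [exact: compact_ecball|exact: segment_compact].
- by move=> z zt; split; [exact: sub|case: zt => /= ? _; rewrite in_itv].
Qed.

(** The points of a tube to which the minimum principle has to be applied lie neither
on the bottom nor on the lateral boundary; all the others are interior in space
and have a past in the tube. *)
Lemma tube_minimum_principle y S a b r (d : 'rV[R]_n -> R -> R) (L : R) :
  0 < r -> continuous y -> (forall z, tube y S a b z -> ecball r z.1) ->
  {within tube y S a b, continuous (fun z => d z.1 z.2)} ->
  (forall x, sqdist x (y a) <= S -> 0 <= d x a) ->
  (forall x t, a < t <= b -> sqdist x (y t) = S -> 0 <= d x t) ->
  (forall x t, a < t <= b -> sqdist x (y t) < S -> d x t < 0 ->
    exists dt l, [/\ is_derive t 1 (d x) dt, is_laplacian (d ^~ t) x l &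
      L * d x t <= dt - l]) ->
  forall x t, a <= t <= b -> sqdist x (y t) <= S -> 0 <= d x t.
Proof.
move=> r0 cy sub cd ini lat int x t tab xS.
apply: (parabolic_minimum_principle (compact_tube r0 cy sub) cd (L := L)); last by split.
move=> {tab xS} {}x {}t [/= /andP[ta tb] xS] dneg.
have {}ta : a < t.
  rewrite lt_neqAle ta andbT; apply/eqP => at'; move: dneg xS.
  by rewrite -at' => dneg xS; have := ini _ xS; lra.
have {}xS : sqdist x (y t) < S.
  rewrite lt_neqAle xS andbT; apply/eqP => xS'.
  have := @lat x t; rewrite ta tb => /(_ isT xS'); lra.
split; last by apply: int => //; rewrite ta.
- have : {for x, continuous (fun x' => sqdist x' (y t))}.
    by apply: continuous_sqdist; [move=> z; exact: cvg_id|exact: cst_continuous].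
  move=> /cvgr_lt /(_ _ xS); apply: filterS => x' /= x'S.
  by rewrite /tube/= ltW// tb ltW.
- have : {for t, continuous (fun t' => sqdist x (y t'))}.
    by apply: continuous_sqdist; [exact: cst_continuous|].
  move=> /cvgr_lt /(_ _ xS) h; near=> s.
  have sS : sqdist x (y s) < S by near: s; exact: cvg_within.
  have st : s < t by near: s; exact: nbhs_left_lt.
  have sa : a < s by near: s; exact: nbhs_left_gt.
  rewrite /tube/= ltW// (ltW sS); split => //; lra.
Unshelve. all: by end_near. Qed.

Lemma within_continuous_precomp {X Y Z : topologicalType} (D : set Y) (K : set X)
    (U : Y -> Z) (phi : X -> Y) :
  {within D, continuous U} -> continuous phi -> (forall z, K z -> D (phi z)) ->
  {within K, continuous (U \o phi)}.
Proof.
move=> /subspace_continuousP cU cphi KD; apply/subspace_continuousP => z Kz.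
apply: cvg_trans (cU _ (KD _ Kz)).
apply: (@cvg_comp _ _ _ phi U _ (within D (nbhs (phi z)))) => // A.
move=> DA; have h : \forall w \near z, D (phi w) -> A (phi w) := cphi z _ DA.
by apply: filterS h => w Aw /KD.
Qed.

Lemma compact_within_bounded {X : topologicalType} (K : set X) (g : X -> R) :
  compact K -> {within K, continuous g} ->
  exists B, 0 <= B /\ forall z, K z -> g z <= B.
Proof.
move=> cK cg; have [z0|K0] := pselect (K !=set0).
  have [z1 _ h] := compact_EVT_max z0 cK cg.
  exists (Num.max 0 (g z1)); split; first by rewrite le_max lexx.
  by move=> z Kz; rewrite le_max h ?orbT ?inE.
by exists 0; split => // z Kz; exfalso; apply: K0; exists z.
Qed.

(** A ball around [x0] of small radius, moved along the segment from [x0] to the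
origin, stays in the large ball. Instead of the triangle inequality the proof uses
|a|^2 <= (1 + 1/e) |a-b|^2 + (1 + e) |b|^2, with e so small that (1+e) |x0|^2 is
still below r^2. *)
Lemma shrink_center r x0 : 0 < r -> eball r x0 -> exists S, 0 < S /\
  forall s x, 0 <= s <= 1 -> sqdist x (s *: x0) <= S -> eball r x.
Proof.
move=> r0 /(eballE _ r0) x0r; pose A := sqdist x0 0.
have A0 : 0 <= A by exact: sqdist_ge0.
pose D := r ^+ 2 - A; have D0 : 0 < D by rewrite /D /A; lra.
pose e := D / (2 * (A + 1)); have e0 : 0 < e by apply: divr_gt0 => //; lra.
pose S := D / (4 * (1 + e^-1)).
have ie0 : 0 < e^-1 by rewrite invr_gt0.
exists S; split; first by apply: divr_gt0 => //; lra.
move=> s x s01 xS; apply/eballE => //.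
have h1 : sqdist x 0 <= (1 + e^-1) * sqdist x (s *: x0) + (1 + e) * A.
  rewrite /A /sqdist !mulr_sumr -big_split/=; apply: ler_sum => i _.
  rewrite !mxE !subr0; set a := x 0 i; set b := x0 0 i.
  have h : (s * b) ^+ 2 <= b ^+ 2.
    by rewrite exprMn ler_piMl ?sqr_ge0// expr_le1//; lra.
  apply: (@le_trans _ _ ((1 + e^-1) * (a - s * b) ^+ 2 + (1 + e) * (s * b) ^+ 2)).
    rewrite -subr_ge0.
    have -> : (1 + e^-1) * (a - s * b) ^+ 2 + (1 + e) * (s * b) ^+ 2 - a ^+ 2 =
      e^-1 * ((a - s * b) - e * (s * b)) ^+ 2.
      by field; rewrite gt_eqF.
    by rewrite mulr_ge0 ?sqr_ge0// ltW.
  by rewrite lerD2l ler_pM2l//; lra.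
have h2 : (1 + e^-1) * sqdist x (s *: x0) <= D / 4.
  apply: (@le_trans _ _ ((1 + e^-1) * S)); first by rewrite ler_pM2l//; lra.
  rewrite /S le_eqVlt; apply/orP; left; apply/eqP; field.
  by rewrite !gt_eqF//; lra.
have h3 : e * A <= D / 2.
  have -> : D / 2 = e * (A + 1) by rewrite /e; field; rewrite gt_eqF//; lra.
  by rewrite ler_pM2l//; lra.
have DE : r ^+ 2 = D + A by rewrite /D subrK.
by rewrite DE; lra.
Qed.

End Tubes.

(** * Comparison in the ball *)

Section BallComparison.
Context {R : realType} {n : nat}.

Lemma within_continuousB {X : topologicalType} (A : set X) (f g : X -> R) :
  {within A, continuous f} -> {within A, continuous g} ->
  {within A, continuous (fun z => f z - g z)}.
Proof. by move=> cf cg z; exact: cvgB (cf z) (cg z). Qed.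

Lemma esphereE r (x : 'rV[R]_n) : 0 < r -> esphere r x <-> sqdist x 0 = r ^+ 2.
Proof.
move=> r0; rewrite /esphere/= enormE; split => [<-|->].
  by rewrite sqr_sqrtr// sqdist_ge0.
by rewrite sqrtr_sqr ger0_norm// ltW.
Qed.

Lemma sphere_subset r (x : 'rV[R]_n) : esphere r x -> ecball r x.
Proof. by rewrite /esphere/ecball/= => ->. Qed.

Lemma ball_subset r (x : 'rV[R]_n) : eball r x -> ecball r x.
Proof. exact: ltW. Qed.

Lemma ecball_cases r (x : 'rV[R]_n) : ecball r x -> eball r x \/ esphere r x.
Proof.
rewrite /ecball/eball/esphere/= le_eqVlt => /predU1P[->|?]; by [right|left].
Qed.

Lemma near_eball r (x : 'rV[R]_n) : 0 < r -> eball r x ->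
  \forall y \near x, eball r y.
Proof.
move=> r0 /(eballE _ r0) xr.
have : {for x, continuous (fun x' : 'rV[R]_n => sqdist x' 0)}.
  by apply: continuous_sqdist; [move=> z; exact: cvg_id|exact: cst_continuous].
by move=> /cvgr_lt /(_ _ xr); apply: filterS => y /(eballE _ r0).
Qed.

Lemma Ck2_is_laplacian D (f : 'rV[R]_n -> R) x :
  (\forall y \near x, D y) -> Ck 2 D f -> is_laplacian f x (laplacian f x).
Proof.
move=> nD [_ C2]; split => // i; split.
  by apply: filterS nD; exact: (C2 i).1.
by have [_ /(_ i)[h _]] := (C2 i).2; apply: h; exact: nbhs_singleton nD.
Qed.

(** Neighbourhoods are given by the sup norm, which is at most the Euclidean norm. *)
Lemma near_sqdist (x : 'rV[R]_n) (P : 'rV[R]_n -> Prop) :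
  (\forall y \near x, P y) -> exists S, 0 < S /\ forall y, sqdist y x <= S -> P y.
Proof.
move=> /nbhs_ballP[e /= e0 He]; exists ((e / 2) ^+ 2); split.
  by rewrite exprn_gt0// divr_gt0.
move=> y yx; apply: He; rewrite mx_norm_ball /ball_/= [ltLHS]/Num.norm/= mx_normrE.
apply/bigmax_ltP; split => // -[i j] _ /=; rewrite (ord1 i) !mxE.
apply: (@le_lt_trans _ _ (e / 2)); last lra.
rewrite -ler_sqr ?nnegrE//; last lra.
rewrite real_normK ?num_real// -sqrrN opprB; apply: le_trans yx.
by rewrite /sqdist (bigD1 j)//= lerDl; apply: sumr_ge0 => k _; exact: sqr_ge0.
Qed.

Variables (r p : R).
Hypotheses (r0 : 0 < r) (p1 : 1 < p).
Implicit Types (v w : 'rV[R]_n -> R -> R).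

Definition supersolution_at v x (t : R) := exists vt lv, [/\ is_derive t 1 (v x) vt,
  is_laplacian (v ^~ t) x lv & lv + reaction p (v x t) <= vt].

Definition subsolution_at w x (t : R) := exists wt lw, [/\ is_derive t 1 (w x) wt,
  is_laplacian (w ^~ t) x lw & wt <= lw + reaction p (w x t)].

Definition cylinder (a b : R) := tube (fun=> 0 : 'rV[R]_n) (r ^+ 2) a b.

Lemma cylinderP a b z : cylinder a b z <-> a <= z.2 <= b /\ ecball r z.1.
Proof. by split => -[? ?]; split => //; apply/ecballE. Qed.

(** The difference v - w satisfies the hypotheses of the minimum principle, with L a
Lipschitz constant of the reaction on the range of [w]: where v < w, both values
lie between 0 and the maximum of [w]. *)
Lemma ball_comparison v w (b : R) :
  {within cylinder 0 b, continuous (fun z => v z.1 z.2)} ->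
  {within cylinder 0 b, continuous (fun z => w z.1 z.2)} ->
  (forall x t, 0 <= t <= b -> ecball r x -> 0 <= v x t) ->
  (forall x, ecball r x -> w x 0 <= v x 0) ->
  (forall x t, 0 < t <= b -> esphere r x -> w x t <= v x t) ->
  (forall x t, 0 < t <= b -> eball r x ->
    supersolution_at v x t /\ subsolution_at w x t) ->
  forall x t, 0 <= t <= b -> ecball r x -> w x t <= v x t.
Proof.
move=> cv cw v0 ini lat int x t tb xr.
have sub z : cylinder 0 b z -> ecball r z.1 by move=> /cylinderP[].
have cy : continuous (fun _ : R => 0 : 'rV[R]_n) by exact: cst_continuous.
have [B [B0 wB]] := compact_within_bounded (compact_tube r0 cy sub) cw.
have [L [L0 HL]] := reaction_lipschitz p1 B.
rewrite -subr_ge0.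
apply: (@tube_minimum_principle _ _ _ _ _ _ _ (fun x t => v x t - w x t) L r0 cy
  sub (within_continuousB cv cw) _ _ _ _ _ tb).
- by move=> x' xr'; rewrite subr_ge0; apply/ini/ecballE.
- by move=> x' t' tb' xr'; rewrite subr_ge0; apply: lat => //; apply/esphereE.
- move=> {xr tb} {}x {}t tb /(eballE _ r0) xb dneg.
  have [[vt [lv [dv Lv sv]]] [wt [lw [dw Lw sw]]]] := int x t tb xb.
  exists (vt - wt), (lv - lw); split; [exact: is_deriveB|exact: is_laplacianB|].
  have tb' : 0 <= t <= b by lra.
  have xb' : ecball r x by exact: ltW.
  have := HL (v x t) (w x t) (v0 _ _ tb' xb').
  have := wB (x, t); rewrite /= => h1.
  have {}h1 : w x t <= B by apply: h1; apply/cylinderP.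
  move=> h2; have {}h2 : L * (v x t - w x t) <=
    reaction p (v x t) - reaction p (w x t) by apply: h2 => //; lra.
  lra.
- exact/ecballE.
Qed.
End BallComparison.

(** * A moving bump *)

Lemma is_derive_linear {R : realType} (c Q t : R) : is_derive t 1 (fun s : R => c * s * Q) (c * Q).
Proof.
have -> : (fun s : R => c * s * Q) = (c * Q) \*: id.
  by apply/funext => s /=; rewrite /GRing.scale/=; ring.
by apply: is_derive_eq; rewrite [LHS]mulr1.
Qed.

Lemma continuous_bump {R : realType} {n : nat} (y : R -> 'rV[R]_n) (S : R) : continuous y ->
  continuous (fun z : 'rV[R]_n * R => S - sqdist z.1 (y z.2)).
Proof.
move=> cy z; apply: cvgB; first exact: cvg_cst.
apply: continuous_sqdist => {}z; first exact: cvg_fst.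
by apply: continuous_comp; [exact: cvg_snd|exact: cy].
Qed.

Lemma is_derive_sqdist_segment {R : realType} {n : nat} (x x0 : 'rV[R]_n) (t s : R) :
  is_derive s 1 (fun s => sqdist x ((1 - s / t) *: x0))
   (\sum_i 2 * (x 0 i - ((1 - s / t) *: x0) 0 i) * (x0 0 i / t)).
Proof.
have -> : (fun s => sqdist x ((1 - s / t) *: x0)) =
   \sum_i (cst (x 0 i - x0 0 i) + (x0 0 i / t) \*: id) ^+ 2.
  apply/funext => s'; rewrite fct_sumE; apply: eq_bigr => i _.
  transitivity ((x 0 i - x0 0 i + (x0 0 i / t) * s') ^+ 2); last by [].
  by rewrite !mxE; ring.
apply: is_derive_sum => i.
apply: is_derive_eq; rewrite add0r expr1 !mxE /GRing.scale/=.
rewrite [X in 2%:R * X](_ : _ = x 0 i - x0 0 i + (x0 0 i / t) * s)//.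
by ring.
Qed.

Lemma continuous_segment {R : realType} {n : nat} (x0 : 'rV[R]_n) (t : R) :
  continuous (fun s : R => (1 - s / t) *: x0).
Proof.
move=> s; apply: cvgZr_tmp; apply: cvgB; first exact: cvg_cst.
by apply: cvgM; [exact: cvg_id|exact: cvg_cst].
Qed.

Lemma sum_2mul_ge {R : realType} (m : nat) (a b : 'I_m -> R) :
  - (\sum_i a i ^+ 2 + \sum_i b i ^+ 2) <= \sum_i 2 * a i * b i.
Proof.
rewrite -big_split -sumrN; apply: ler_sum => i _ /=.
by rewrite -subr_ge0 opprK; have := sqr_ge0 (a i + b i); rewrite sqrrD; lra.
Qed.

(** With q = S - s and s = |x - y(t)|^2, this says that exp(-A t) q^2 is a subsolution
of the heat equation: qs is minus the time derivative of q, and 8 s - 4 N q is the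
Laplacian of q^2 in dimension N. Replacing qs by its lower bound -(S + W) leaves
A q^2 - B q + 8 S, which is a multiple of a square for A = B^2/(32 S). *)
Lemma bump_inequality {R : realType} (S W N A B q s qs : R) : 0 < S -> q = S - s -> 0 < q ->
  0 <= s -> - (s + W) <= qs -> 0 <= W ->
  B = 2 * (S + W) + 4 * N + 8 -> A = B ^+ 2 / (32 * S) -> 0 <= N ->
  0 <= A * q ^+ 2 + 2 * q * qs + 8 * s - 4 * N * q.
Proof.
move=> S0 qE q0 s0 hqs W0 BE AE N0.
have h1 : 0 <= A * q ^+ 2 - B * q + 8 * S.
  have -> : A * q ^+ 2 - B * q + 8 * S = (32 * S)^-1 * (B * q - 16 * S) ^+ 2.
    by rewrite AE; field; rewrite gt_eqF.
  by rewrite mulr_ge0 ?sqr_ge0// invr_ge0; lra.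
have h2 : - (q * (S + W)) <= q * qs.
  by rewrite -mulrN ler_pM2l//; lra.
have -> : A * q ^+ 2 + 2 * q * qs + 8 * s - 4 * N * q =
  (A * q ^+ 2 - B * q + 8 * S) + 2 * (q * qs + q * (S + W)).
  by rewrite BE qE; ring.
by lra.
Qed.

(** * From the differential inequality to the rate *)

(** The hypothesis gives M' >= k exp(p M), so H = exp(-p M) + p k t is nonincreasing.
Since exp(-p M) is positive, comparing H at [t] with H at times close to [T] gives
the bound. *)
Lemma blow_up_rate {R : realType} (M dM : R -> R) (p k a T : R) : 0 < p -> 0 < k ->
  (forall t, a <= t < T -> is_derive t 1 M (dM t)) ->
  (forall t h, 0 <= h -> a <= t -> t + h < T ->
    k * h * expR (p * M t) <= M (t + h) - M t) ->
  forall t, a <= t < T -> p * k * (T - t) <= expR (- (p * M t)).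
Proof.
move=> p0 k0 hd hM.
have dMk t : a <= t < T -> k * expR (p * M t) <= dM t.
  move=> aT; apply: (derive_ge_increment (hd _ aT)); near=> s.
  have st : s < t by near: s; exact: nbhs_left_lt.
  have Ts : t - (T - t) < s by near: s; apply: nbhs_left_gt; lra.
  have := hM t (t - s) ltac:(lra) ltac:(lra) ltac:(lra).
  by rewrite lerBrDl mulrAC.
pose H (t : R) := expR (- (p * M t)) + p * k * t.
have dH t : a <= t < T -> is_derive t 1 H (expR (- (p * M t)) * (- (p * dM t)) + p * k).
  move=> aT; have := hd _ aT => ?.
  have d1 : is_derive t 1 (- (p \*: M)) (- (p * dM t)) by apply: is_deriveN.
  have d2 : is_derive t 1 (expR \o (- (p \*: M))) (expR (- (p * M t)) * (- (p * dM t))).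
    by apply: is_derive1_comp.
  have : is_derive t 1 (expR \o (- (p \*: M)) + (p * k) \*: id)
    (expR (- (p * M t)) * (- (p * dM t)) + p * k).
    by apply: is_derive_eq; rewrite [(p * k)%:A]mulr1.
  by [].
have Hle t s : a <= t -> t <= s -> s < T -> H s <= H t.
  move=> at' ts sT.
  apply: (@ler0_derive1_nincr _ H t s) => //.
  - by move=> x; rewrite in_itv/= => xs; apply: ex_derive; apply: dH; lra.
  - move=> x; rewrite in_itv/= => xs; have xT : a <= x < T by lra.
    rewrite derive1E; have [_ ->] := dH x xT.
    have := dMk x xT; rewrite -(ler_pM2l (expR_gt0 (- (p * M x)))).
    rewrite mulrCA -expRD addNr expR0 mulr1 -(ler_pM2l p0).
    rewrite mulrN (mulrCA _ p); move: (p * (_ * _)) (p * k) => b c; lra.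
  - apply: derivable_within_continuous => x; rewrite in_itv/= => xs.
    by apply: ex_derive; apply: dH; lra.
move=> t atT; rewrite leNgt; apply/negP => hlt.
pose G := expR (- (p * M t)).
have pk : 0 < p * k by rewrite mulr_gt0.
have G0 : 0 < G by exact: expR_gt0.
(* A time with p k (s - t) > G, which exists as G / (p k) < T - t. *)
pose s := (t + G / (p * k) + T) / 2.
have h1 : G / (p * k) < T - t by rewrite ltr_pdivrMr// mulrC.
have h2 : 0 < G / (p * k) by rewrite divr_gt0.
have h3 : t <= s by rewrite /s; lra.
have h4 : s < T by rewrite /s; lra.
have := Hle t s ltac:(lra) h3 h4; rewrite /H -/G.
have := expR_gt0 (- (p * M s)).
have : p * k * (s - t) > G.
  by rewrite mulrC -ltr_pdivrMr// /s; lra.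
rewrite mulrBr; move: (expR _) (p * k * s) (p * k * t) => x y z; lra.
Unshelve. all: by end_near. Qed.

(** * Monotonicity in time *)

Lemma continuous_sub_dist {R : realType} {X : topologicalType} (f g : X -> R)
    (a b c : R) : continuous f -> continuous g ->
  continuous (fun x => f x + a - b * `|g x - c|).
Proof.
move=> cf cg x; apply: cvgB; first by apply: cvgD; [exact: cf|exact: cvg_cst].
apply: cvgM; first exact: cvg_cst.
by apply: cvg_norm; apply: cvgB; [exact: cg|exact: cvg_cst].
Qed.

Section Solution.
Context {R : realType} {n : nat}.
Variables (r p T : R) (u0 : 'rV[R]_n -> R) (u : 'rV[R]_n -> R -> R).
Hypotheses (r0 : 0 < r) (p1 : 1 < p) (T0 : 0 < T).
Hypothesis sol : classical_solution r p T u0 u.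

Lemma sol_derivative x t : eball r x -> 0 < t < T ->
  is_derive t 1 (u x) (laplacian (u ^~ t) x + reaction p (u x t)).
Proof.
move=> xr tT; have [d _] := cs_C1 sol xr tT.
by split => //; rewrite -derive1E (cs_eq sol xr tT).
Qed.

Lemma sol_laplacian x t : eball r x -> 0 < t < T ->
  is_laplacian (u ^~ t) x (laplacian (u ^~ t) x).
Proof.
by move=> xr tT; apply: Ck2_is_laplacian (cs_C2 sol tT); exact: near_eball.
Qed.

Lemma sol_shift_derivative x t h : eball r x -> 0 < t + h < T ->
  is_derive t 1 (fun s => u x (s + h))
    (laplacian (u ^~ (t + h)) x + reaction p (u x (t + h))).
Proof.
move=> xr tT.
have d1 := sol_derivative xr tT.
have : is_derive t 1 (u x \o shift h)
    ((laplacian (u ^~ (t + h)) x + reaction p (u x (t + h))) * 1).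
  by apply: is_derive1_comp; exact: is_derive_shift.
by rewrite mulr1.
Qed.

Lemma sol_continuous (K : set ('rV[R]_n * R)) h :
  (forall z, K z -> ecball r z.1 /\ 0 <= z.2 + h < T) ->
  {within K, continuous (fun z => u z.1 (z.2 + h))}.
Proof.
move=> KD.
have := @within_continuous_precomp _ _ _ _ K (fun z => u z.1 z.2)
  (fun z => (z.1, z.2 + h)) (cs_continuous sol).
apply; last by move=> z /KD[].
move=> z; have ch : (fun z : 'rV[R]_n * R => z.2 + h) @ z --> z.2 + h.
  by apply: cvgD; [exact: cvg_snd|exact: cvg_cst].
exact: cvg_pair cvg_fst ch.
Qed.

Lemma sol_continuous0 (K : set ('rV[R]_n * R)) :
  (forall z, K z -> ecball r z.1 /\ 0 <= z.2 < T) ->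
  {within K, continuous (fun z => u z.1 z.2)}.
Proof.
move=> KD; have := @sol_continuous K 0.
under eq_fun do rewrite addr0; apply => z /KD.
by rewrite addr0.
Qed.

Lemma sol_supersolution_at x t h : eball r x -> 0 < t + h < T ->
  supersolution_at p (fun x t => u x (t + h)) x t.
Proof.
move=> xr tT; exists (laplacian (u ^~ (t + h)) x + reaction p (u x (t + h))).
exists (laplacian (u ^~ (t + h)) x); split => //.
  exact: sol_shift_derivative.
exact: sol_laplacian.
Qed.

Lemma sol_subsolution_at x t : eball r x -> 0 < t < T ->
  subsolution_at p u x t.
Proof.
move=> xr tT; exists (laplacian (u ^~ t) x + reaction p (u x t)).
exists (laplacian (u ^~ t) x); split => //.
  exact: sol_derivative.
exact: sol_laplacian.
Qed.

Lemma sol_supersolution_at0 x t : eball r x -> 0 < t < T ->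
  supersolution_at p u x t.
Proof.
move=> xr tT; exists (laplacian (u ^~ t) x + reaction p (u x t)).
exists (laplacian (u ^~ t) x); split => //.
  exact: sol_derivative.
exact: sol_laplacian.
Qed.

(** The boundary condition is only imposed for positive times; at time 0 it follows by
continuity. *)
Lemma sol_sphere0 x : esphere r x -> u x 0 = 0.
Proof.
move=> xr; pose D := (ecball r : set 'rV[R]_n) `*` [set t : R | 0 <= t < T].
have D0 : D (x, 0).
  by split; [exact: sphere_subset|rewrite /= lexx].
have /subspace_continuousP/(_ _ D0) cU := cs_continuous sol.
have c1 : u x s @[s --> 0^'+] --> u x 0.
  apply: (@cvg_comp _ _ _ (fun s : R => (x, s)) (fun z => u z.1 z.2) _
    (within D (nbhs (x, 0))) _ _ cU) => A.
  have h : (x, s) @[s --> (0 : R)] --> (x, 0 : R).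
    have h1 : x @[s --> (0 : R)] --> x by exact: cvg_cst.
    have h2 : s @[s --> (0 : R)] --> (0 : R) by exact: cvg_id.
    exact: cvg_pair h1 h2.
  move=> DA; have {}h : \forall s \near (0 : R), D (x, s) -> A (x, s) := h _ DA.
  suff : \forall s \near 0^'+, A (x, s) by [].
  near=> s.
  have hs : D (x, s) -> A (x, s) by near: s; exact: cvg_within.
  apply: hs; split; first exact: sphere_subset.
  by apply/andP; split; near: s; [exact: nbhs_right_ge|exact: nbhs_right_lt].
have c2 : u x s @[s --> 0^'+] --> 0.
  apply: cvg_near_cst; near=> s; apply: (cs_boundary sol) => //.
  by apply/andP; split; near: s; [exact: nbhs_right_gt|exact: nbhs_right_lt].
exact: (cvg_unique _ c1 c2).
Unshelve. all: by end_near. Qed.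

(* In the application [g] is a smooth function on the whole space that extends the
initial datum, so that it can be differentiated and is continuous everywhere. *)
Variable g : 'rV[R]_n -> R.
Hypotheses (gC2 : Ck 2 setT g) (g_ge0 : forall x, ecball r x -> 0 <= g x)
  (g_sphere : forall x, esphere r x -> g x = 0)
  (g_init : forall x, eball r x -> u x 0 = g x)
  (g_sub : forall x, eball r x -> 0 <= laplacian g x + reaction p (g x)).

Lemma g_continuous : continuous g.
Proof. by case: gC2 => h _ x; exact: h. Qed.

Lemma g_laplacian x : is_laplacian g x (laplacian g x).
Proof. by apply: Ck2_is_laplacian gC2; exact: filterE. Qed.

Lemma g_within (K : set ('rV[R]_n * R)) : {within K, continuous (fun z => g z.1)}.
Proof.
apply: continuous_subspaceT => z.
by apply: continuous_comp; [exact: cvg_fst|exact: g_continuous].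
Qed.

Lemma cylinder_domain b (z : 'rV[R]_n * R) : b < T -> cylinder r 0 b z ->
  ecball r z.1 /\ 0 <= z.2 < T.
Proof. by move=> bT /(cylinderP r0)[zb zr]; split => //; lra. Qed.

(** The initial datum, constant in time, is a subsolution. *)
Lemma sol_ge_initial x t : ecball r x -> 0 <= t < T -> g x <= u x t.
Proof.
move=> xr tT.
apply: (@ball_comparison _ _ _ _ r0 p1 u (fun x _ => g x) t) => //.
- apply: sol_continuous0 => z; apply: cylinder_domain; lra.
- exact: g_within.
- by move=> x' t' t't x'r; apply: (cs_ge0 sol) => //; lra.
- move=> x' x'r; have [/g_init ->//|s] := ecball_cases x'r.
  by rewrite g_sphere// (cs_ge0 sol)// lexx.
- by move=> x' t' t't s; rewrite g_sphere// (cs_boundary sol)//; lra.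
- move=> x' t' t't x'r; split; first by apply: sol_supersolution_at0 => //; lra.
  exists 0, (laplacian g x'); split; [exact: is_derive_cst|exact: g_laplacian|].
  exact: g_sub.
- lra.
Qed.

(** The solution shifted in time by [h] starts above the initial datum, hence above the
solution. *)
Lemma sol_nondecreasing x t h : ecball r x -> 0 <= t -> 0 <= h -> t + h < T ->
  u x t <= u x (t + h).
Proof.
move=> xr t0 h0 thT.
apply: (@ball_comparison _ _ _ _ r0 p1 (fun x t => u x (t + h)) u t) => //.
- by apply: sol_continuous => z /(cylinderP r0)[zb zr]; split => //; lra.
- by apply: sol_continuous0 => z; apply: cylinder_domain; lra.
- by move=> x' t' t't x'r; apply: (cs_ge0 sol) => //; lra.
- move=> x' x'r; rewrite add0r; have [x''|s] := ecball_cases x'r.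
    by rewrite g_init//; apply: sol_ge_initial => //; lra.
  by rewrite sol_sphere0// (cs_ge0 sol)//; lra.
- by move=> x' t' t't s; rewrite !(cs_boundary sol)//; lra.
- move=> x' t' t't x'r; split; first by apply: sol_supersolution_at => //; lra.
  by apply: sol_subsolution_at => //; lra.
- lra.
Qed.

(** * Growth of the solution in time *)

(** Otherwise the initial datum would be stationary, hence a supersolution above [u],
and [u] would be bounded. *)
Lemma strict_residual : blow_up_point r T u 0 ->
  exists x0, eball r x0 /\ 0 < laplacian g x0 + reaction p (g x0).
Proof.
move=> [_ [x_ [t_ [xt _ _ ucvg]]]].
apply: contrapT => hno.
have g0 x : eball r x -> laplacian g x + reaction p (g x) = 0.
  move=> xr; apply/eqP; rewrite eq_le g_sub// andbT leNgt; apply/negP => h.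
  by apply: hno; exists x.
have le x t : ecball r x -> 0 <= t < T -> u x t <= g x.
  move=> xr tT.
  apply: (@ball_comparison _ _ _ _ r0 p1 (fun x _ => g x) u t) => //.
  - exact: g_within.
  - apply: sol_continuous0 => z; apply: cylinder_domain; lra.
  - by move=> x' t' t't x'r; exact: g_ge0.
  - move=> x' x'r; have [/g_init ->//|s] := ecball_cases x'r.
    by rewrite g_sphere// sol_sphere0.
  - by move=> x' t' t't s; rewrite g_sphere// (cs_boundary sol)//; lra.
  - move=> x' t' t't x'r; split; last by apply: sol_subsolution_at => //; lra.
    exists 0, (laplacian g x'); split; [exact: is_derive_cst|exact: g_laplacian|].
    by rewrite g0.
  - lra.
have [B [B0 gB]] := compact_within_bounded (@compact_ecball R n r r0)
  (continuous_subspaceT g_continuous (A := ecball r)).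
have /cvgryPgt/(_ B)[N _ /(_ N (leqnn N))/=] := ucvg.
have [xN tN] := xt N.
have tN' : 0 <= t_ N < T by lra.
by have := le _ _ xN tN'; have := gB _ xN; lra.
Qed.

(** As [x `^ p] is not continuous at 0 from the left, continuity of the reaction is
replaced by the lower bound f(g x) >= f(g x0) - L |g x - g x0|, which holds as long
as [g] is nonnegative. *)
Lemma residual_near x0 : eball r x0 -> 0 < laplacian g x0 + reaction p (g x0) ->
  exists k, 0 < k /\ \forall x \near x0,
    eball r x /\ k <= laplacian g x + reaction p (g x).
Proof.
move=> x0r res0.
have [L [L0 HL]] := reaction_lipschitz p1 (g x0).
pose k := (laplacian g x0 + reaction p (g x0)) / 2.
have k0 : 0 < k by rewrite /k; lra.
exists k; split => //.
have cl : continuous (laplacian g).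
  apply: continuous_big; first exact: add_continuous.
  by move=> i _ x; have [_ /(_ i)[_ h]] := (gC2.2 i).2; exact: h.1.
have cF : {for x0, continuous (fun x => laplacian g x + reaction p (g x0) -
    L * `|g x - g x0|)}.
  exact: continuous_sub_dist cl g_continuous _.
have kF : k < laplacian g x0 + reaction p (g x0) - L * `|g x0 - g x0|.
  by rewrite subrr normr0 mulr0 subr0 /k; lra.
have h1 : \forall x \near x0,
    k < laplacian g x + reaction p (g x0) - L * `|g x - g x0|.
  by have := cvgr_gt _ cF _ kF; apply.
near=> x; have xr : eball r x by near: x; exact: near_eball.
have kx : k < laplacian g x + reaction p (g x0) - L * `|g x - g x0| by near: x.
split; first exact: xr.
apply: ltW; apply: lt_le_trans kx _; rewrite -addrA lerD2l.
have gx := g_ge0 (ball_subset xr); have gx0 := g_ge0 (ball_subset x0r).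
have [h|h] := leP (g x) (g x0).
  have := HL _ _ gx h (lexx _); rewrite ler0_norm ?subr_le0// mulrN opprK.
  by rewrite lerBrDl.
apply: le_trans (le_reaction p1 gx0 (ltW h)).
by rewrite gerBl mulr_ge0.
Unshelve. all: by end_near. Qed.

(** The paraboloid c t (S - |x - x0|^2), added to the initial datum, remains a
subsolution as long as its time derivative and its Laplacian do not use up the
excess [k] of the residual. *)
Lemma initial_growth x0 S k : 0 < S -> 0 < k ->
  (forall x, sqdist x x0 <= S ->
    eball r x /\ k <= laplacian g x + reaction p (g x)) ->
  exists c, 0 < c /\ forall x t, 0 <= t < T -> sqdist x x0 <= S ->
    g x + c * t * (S - sqdist x x0) <= u x t.
Proof.
move=> S0 k0 res.
have n0 : 0 <= n%:R :> R by rewrite ler0n.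
have nT0 : 0 <= n%:R * T by rewrite mulr_ge0// ltW.
(* The derivative in time costs at most c S and the Laplacian at most 2 n c T. *)
pose c := k / (S + 2 * n%:R * T + 1).
have den0 : 0 < S + 2 * n%:R * T + 1 by lra.
have c0 : 0 < c by rewrite divr_gt0.
have ck : c * S + c * (2 * n%:R * T) + c = k.
  by rewrite /c; field; rewrite gt_eqF.
exists c; split => // x t tT xS.
have gle := sol_ge_initial.
rewrite -subr_ge0 opprD addrA.
have cy : continuous (fun _ : R => x0) by exact: cst_continuous.
have sub z : tube (fun=> x0) S 0 t z -> ecball r z.1.
  by move=> [_ /res[/ball_subset]].
apply: (@tube_minimum_principle _ _ (fun=> x0) S 0 t r
  (fun x t => u x t - g x - c * t * (S - sqdist x x0)) 0 r0 cy sub) => //.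
- apply: within_continuousB.
    apply: within_continuousB; last exact: g_within.
    apply: sol_continuous0 => z zt; split; first exact: sub.
    by case: zt => /= ? _; lra.
  apply: continuous_subspaceT => z; apply: cvgM; last exact: continuous_bump.
  by apply: cvgM; [exact: cvg_cst|exact: cvg_snd].
- move=> x' x'S; rewrite mulr0 mul0r subr0 subr_ge0.
  by apply: gle; [apply: ball_subset; exact: (res _ x'S).1|lra].
- move=> x' t' t't x'S; rewrite x'S subrr mulr0 subr0 subr_ge0.
  have x'S' : sqdist x' x0 <= S by rewrite x'S.
  by apply: gle; [apply: ball_subset; exact: (res _ x'S').1|lra].
- move=> x' t' t't x'S dneg.
  have [x'r resx] := res _ (ltW x'S).
  have t'T : 0 < t' < T by lra.
  exists (laplacian (u ^~ t') x' + reaction p (u x' t') - 0 - c * (S - sqdist x' x0)).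
  exists (laplacian (u ^~ t') x' - laplacian g x' - c * t' * (0 - 2 * n%:R)).
  split.
  + apply: is_deriveB (is_derive_linear _ _ _).
    by apply: is_deriveB; exact: (sol_derivative x'r t'T).
  + apply: is_laplacianB.
      by apply: is_laplacianB; [exact: sol_laplacian|exact: g_laplacian].
    apply: is_laplacianZ; apply: is_laplacianB.
      exact: is_laplacian_cst.
    exact: is_laplacian_sqdist.
  + have gu : g x' <= u x' t' by apply: gle; [exact: ball_subset|lra].
    have := le_reaction p1 (g_ge0 (ball_subset x'r)) gu.
    have : c * (S - sqdist x' x0) <= c * S.
      by rewrite ler_pM2l// lerBlDr lerDl sqdist_ge0.
    have : c * t' * (2 * n%:R) <= c * (2 * n%:R * T).
      by rewrite -mulrA ler_pM2l// mulrC ler_wpM2l ?mulr_ge0//; lra.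
    rewrite mul0r (sub0r (2 * n%:R)) (mulrN (c * t')); move: resx ck c0.
    move: (c * (S - sqdist x' x0)) (c * S) (c * t' * (2 * n%:R)) (c * (2 * n%:R * T)).
    move: (laplacian g x') (laplacian _ x') (reaction p (g x')) (reaction p _).
    by clear => *; lra.
- by case/andP: tT => -> _; rewrite lexx.
Qed.

(** The gain of [initial_growth] around [x0] is transported to the origin along a
segment traversed in time [t], so with speed at most 2|x0|/T. The comparison
function is a multiple of exp(-A s) (S - |x - y(s)|^2)^2, which vanishes on the
lateral boundary of the tube; [h] enters only as a factor, and A does not depend
on [t] because the speed is bounded. *)
Lemma increment_lower_bound (x0 : 'rV[R]_n) (S c : R) : 0 < S -> 0 < c ->
  (forall s x, 0 <= s <= 1 -> sqdist x (s *: x0) <= S -> eball r x) ->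
  (forall x t, 0 <= t < T -> sqdist x x0 <= S ->
    g x + c * t * (S - sqdist x x0) <= u x t) ->
  exists c1, 0 < c1 /\ forall x t h, 0 <= h -> T / 2 <= t -> t + h < T ->
    sqdist x 0 <= S / 2 -> c1 * h <= u x (t + h) - u x t.
Proof.
move=> S0 c0 inball growth.
pose W : R := \sum_i (x0 0 i / (T / 2)) ^+ 2.
have W0 : 0 <= W by apply: sumr_ge0 => i _; exact: sqr_ge0.
pose B := 2 * (S + W) + 4 * n%:R + 8.
pose A := B ^+ 2 / (32 * S).
have A0 : 0 <= A by rewrite divr_ge0 ?sqr_ge0//; lra.
have n0 : 0 <= n%:R :> R by rewrite ler0n.
exists (c * S * expR (- A * T) / 4); split.
  by rewrite divr_gt0// !mulr_gt0// expR_gt0.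
move=> x t h h0 tT thT xS.
have t0 : 0 < t by lra.
have it : t^-1 ^+ 2 <= (T / 2)^-1 ^+ 2.
  have T2 : 0 < T / 2 by lra.
  by rewrite ler_sqr ?nnegrE ?invr_ge0 ?(ltW t0) ?(ltW T2)// lef_pV2.
pose y (s : R) := (1 - s / t) *: x0.
have y0 : y 0 = x0 by rewrite /y mul0r subr0 scale1r.
have yt : y t = 0 by rewrite /y divff ?gt_eqF// subrr scale0r.
have inb x' s : 0 <= s <= t -> sqdist x' (y s) <= S -> eball r x'.
  move=> /andP[s0 st]; apply: inball.
  have : 0 <= s / t by rewrite divr_ge0// ltW.
  have : s / t <= 1 by rewrite ler_pdivrMr ?mul1r.
  by move=> ? ?; lra.
pose a := c * h / S.
have a0 : 0 <= a by rewrite divr_ge0 ?mulr_ge0// ltW.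
pose E (s : R) := expR (- A * s).
have E0 s : 0 < E s by exact: expR_gt0.
have dE (s : R) : is_derive s 1 E (- A * E s).
  have : is_derive s 1 (expR \o (- A \*: id)) (expR (- A * s) * (- A * 1)).
    by apply: is_derive1_comp.
  by move=> ?; apply: is_derive_eq; rewrite mulr1 mulrC.
have cE : continuous E.
  by move=> s; apply: continuous_comp; [exact: mulrl_continuous|exact: continuous_expR].
pose d (x : 'rV[R]_n) (s : R) := u x (s + h) - u x s - a * E s * (S - sqdist x (y s)) ^+ 2.
have sub z : tube y S 0 t z -> ecball r z.1.
  by move=> [zt zS]; apply: ball_subset; exact: inb zt zS.
suff : 0 <= d x t.
  rewrite /d yt subr_ge0; apply: le_trans.
  have -> : c * S * expR (- A * T) / 4 * h = a * expR (- A * T) * (S / 2) ^+ 2.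
    by rewrite /a; field; rewrite gt_eqF.
  apply: ler_pM; [by rewrite mulr_ge0// expR_ge0|exact: sqr_ge0|..].
    apply: ler_wpM2l => //; rewrite /E ler_expR !mulNr lerN2.
    by apply: ler_wpM2l => //; lra.
  by rewrite ler_sqr ?nnegrE; lra.
have xSt : sqdist x (y t) <= S by rewrite yt; lra.
apply: (@tube_minimum_principle _ _ y S 0 t r d 0 r0 _ sub) => //.
- exact: continuous_segment.
- apply: within_continuousB.
    apply: within_continuousB.
      apply: sol_continuous => z zt; split; first exact: sub.
      by case: zt => /= ? _; lra.
    apply: sol_continuous0 => z zt; split; first exact: sub.
    by case: zt => /= ? _; lra.
  have cq := @continuous_bump _ _ y S (@continuous_segment _ _ x0 t).
  apply: continuous_subspaceT => z; apply: cvgM.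
    apply: cvgM; first exact: cvg_cst.
    by apply: continuous_comp; [exact: cvg_snd|exact: cE].
  by rewrite expr2; under eq_fun do rewrite expr2; apply: cvgM; exact: cq.
- move=> x' x'S; rewrite /d /E y0 mulr0 expR0 mulr1 add0r subr_ge0.
  have x'S' : sqdist x' (y 0) <= S := x'S.
  rewrite y0 in x'S'.
  have x'r : eball r x' by apply: (inb _ 0) => //; rewrite lexx ltW.
  have := @growth x' h; rewrite (g_init x'r) => gr.
  have {}gr : g x' + c * h * (S - sqdist x' x0) <= u x' h by apply: gr => //; lra.
  rewrite lerBrDl; apply: le_trans gr; rewrite lerD2l.
  have -> : a * (S - sqdist x' x0) ^+ 2 =
     c * h * (S - sqdist x' x0) * ((S - sqdist x' x0) / S).
     by rewrite /a; field; rewrite gt_eqF.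
  rewrite ler_piMr//.
    by rewrite !mulr_ge0 ?subr_ge0// ltW.
  by rewrite ler_pdivrMr// mul1r gerBl sqdist_ge0.
- move=> x' s st x'S; rewrite /d x'S subrr expr0n/= mulr0 subr0 subr_ge0.
  apply: sol_nondecreasing => //; try lra.
  by apply: ball_subset; apply: (inb _ s); rewrite ?x'S//; lra.
- move=> x' s st x'S _.
  have x'r : eball r x' by apply: (inb _ s); lra.
  have sT : 0 < s < T by lra.
  have shT : 0 < s + h < T by lra.
  pose qs := \sum_i 2 * (x' 0 i - (y s) 0 i) * (x0 0 i / t).
  pose q := S - sqdist x' (y s).
  have q0 : 0 < q by rewrite subr_gt0.
  exists ((laplacian (u ^~ (s + h)) x' + reaction p (u x' (s + h))) -
     (laplacian (u ^~ s) x' + reaction p (u x' s)) -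
     (a * E s * (- A * q ^+ 2 - 2 * q * qs))).
  exists (laplacian (u ^~ (s + h)) x' - laplacian (u ^~ s) x' -
     a * E s * (8 * sqdist x' (y s) - 4 * n%:R * q)).
  split.
  + apply: is_deriveB.
      by apply: is_deriveB; [exact: sol_shift_derivative|exact: sol_derivative].
    have dq := is_derive_sqdist_segment x' x0 t s.
    have : is_derive s 1 ((a \*: E) * (cst S - (fun s => sqdist x' (y s))) ^+ 2)
       (a * E s * (- A * q ^+ 2 - 2 * q * qs)).
      apply: is_derive_eq.
      change (a * E s * (2 * q * (0 - qs)) + q ^+ 2 * (a * (- A * E s)) =
        a * E s * (- A * q ^+ 2 - 2 * q * qs)).
      by ring.
    by [].
  + apply: is_laplacianB.
      by apply: is_laplacianB; exact: sol_laplacian.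
    apply: is_laplacianZ.
    have -> : 8 * sqdist x' (y s) - 4 * n%:R * q = - 2 * q * (2 * n%:R) +
       2 * \sum_i partial i (sqdist ^~ (y s)) x' ^+ 2.
      under eq_bigr do rewrite partial_sqdist exprMn.
      by rewrite -mulr_sumr -/(sqdist x' (y s)); ring.
    apply: (@is_laplacian_comp _ _ (fun b => (S - b) ^+ 2)
      (fun b => - 2 * (S - b)) (fun=> 2)); last exact: is_laplacian_sqdist.
      move=> b; have : is_derive b 1 ((cst S - id) ^+ 2) (- 2 * (S - b)).
        apply: is_derive_eq.
        change (2 * (S - b) * (0 - 1) = - 2 * (S - b)).
        by ring.
      by [].
    move=> b; have : is_derive b 1 (- 2 \*: (cst S - id)) (2 : R).
      by apply: is_derive_eq; rewrite /GRing.scale/=; ring.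
    by [].
  + rewrite mul0r.
    have um : u x' s <= u x' (s + h).
      by apply: sol_nondecreasing; [exact: ball_subset|lra..].
    have fm : reaction p (u x' s) <= reaction p (u x' (s + h)).
      by apply: le_reaction => //; apply: (cs_ge0 sol); [exact: ball_subset|lra].
    have cross : - (sqdist x' (y s) + W) <= qs.
      apply: le_trans (sum_2mul_ge _ _); rewrite lerN2 lerD2l.
      by apply: ler_sum => i _; rewrite !exprMn ler_wpM2l ?sqr_ge0.
    have := bump_inequality S0 (erefl q) q0 (sqdist_ge0 _ _) cross W0
      (erefl B) (erefl A) n0.
    move=> /(mulr_ge0 (mulr_ge0 a0 (ltW (E0 s)))).
    move: (laplacian (u ^~ (s + h)) x') (laplacian (u ^~ s) x') (a * E s)
      (reaction p (u x' (s + h))) (reaction p (u x' s)) fm => l2 l1 e f2 f1 fm h3.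
    rewrite [leRHS](_ : _ = (f2 - f1) +
      e * (A * q ^+ 2 + 2 * q * qs + 8 * sqdist x' (y s) - 4 * n%:R * q)).
      by rewrite addr_ge0// subr_ge0.
    by ring.
- by rewrite lexx ltW.
Qed.

(** * Boundedness away from the origin *)

(** If [u] were unbounded near (x, T), points in balls of radius 1/(k+1) around (x, T)
with values above k would make [x] a blow-up point. *)
Lemma not_blow_up_bounded (x : 'rV[R]_n) : ecball r x ->
  ~ blow_up_point r T u x ->
  exists K, \forall z \near (x, T), ecball r z.1 -> 0 < z.2 < T -> u z.1 z.2 <= K.
Proof.
move=> xr nb; apply: contrapT => /forallNP hno; apply: nb; split => //.
have /choice[z_ Hz] : forall k : nat, exists z : 'rV[R]_n * R,
    [/\ ball (x, T) k.+1%:R^-1 z, ecball r z.1, 0 < z.2 < T & k%:R < u z.1 z.2].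
  move=> k; apply: contrapT => /forallNP hk; apply: (hno k%:R).
  apply/nbhs_ballP; exists k.+1%:R^-1; first by rewrite /= invr_gt0.
  move=> z xz zr zT; rewrite leNgt; apply/negP => kz.
  by apply: (hk z).
have bz (e : R) : 0 < e -> \forall k \near \oo, ball (x, T) e (z_ k).
  move=> e0; have := near_infty_natSinv_lt (PosNum e0); apply: filterS => k /= ke.
  by have [+ _ _ _] := Hz k; apply: le_ball; exact: ltW.
exists (fun k => (z_ k).1), (fun k => (z_ k).2); split.
- by move=> k; have [_ ? ? _] := Hz k.
- by apply/cvg_ballP => e /bz; apply: filterS => k [].
- by apply/cvg_ballP => e /bz; apply: filterS => k [].
- apply/cvgryPge => a; have := @nbhs_infty_ger R a; apply: filterS => k ak.
  by have [_ _ _ /ltW] := Hz k; exact: le_trans.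
Qed.

(** By compactness of the sphere times [T/2, T] it suffices that [u] be locally bounded
there: at times before [T] by continuity, at time [T] because no point of the
sphere is a blow-up point. *)
Lemma sphere_bound (E : R) : (forall x, blow_up_point r T u x -> x = 0) ->
  0 < E -> (forall x : 'rV[R]_n, sqdist x 0 = E -> ecball r x) ->
  exists K : R, forall x t, sqdist x 0 = E -> T / 2 <= t < T -> u x t <= K.
Proof.
move=> only0 E0 Er.
pose C : set ('rV[R]_n * R) := [set z | sqdist z.1 0 = E /\ T / 2 <= z.2 <= T].
have cC : compact C.
  apply: (@subclosed_compact _ _ (ecball r `*` `[T / 2, T])).
  - have -> : C = ((fun z : 'rV[R]_n * R => sqdist z.1 0) @^-1` [set E]) `&`
        (snd @^-1` `[T / 2, T]).
      by apply/seteqP; split => z; rewrite /C/= in_itv/=.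
    apply: closedI; apply: preimage_closed.
    + move=> z _; apply: continuous_sqdist; last exact: cst_continuous.
      by move=> z'; exact: cvg_fst.
    + exact: closed_eq.
    + by move=> z _; exact: cvg_snd.
    + exact: interval_closed.
  - by apply: compact_setX; [exact: compact_ecball|exact: segment_compact].
  - by move=> z [zE zT]; split; [exact: Er|rewrite /= in_itv].
have locb z : C z -> exists K, \forall z' \near z, C z' -> z'.2 < T ->
    u z'.1 z'.2 <= K.
  move=> [zE /andP[zT zT']].
  have [zT''|Tz] := ltP z.2 T.
    have Dz : (ecball r `*` [set t : R | 0 <= t < T]) z.
      by split; [exact: Er|apply/andP; split => //; lra].
    have /subspace_continuousP/(_ _ Dz) cU := cs_continuous sol.
    exists (u z.1 z.2 + 1).
    have h : u z.1 z.2 < u z.1 z.2 + 1 by rewrite ltrDl.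
    have {}h : \forall z' \near within (ecball r `*` [set t : R | 0 <= t < T])
      (nbhs z), u z'.1 z'.2 < u z.1 z.2 + 1 by have := cvgr_lt _ cU _ h; apply.
    move: h; rewrite near_withinE; apply: filterS => z' h [z'E /andP[Tz' _]] z'T.
    by apply/ltW/h; split; [exact: Er|apply/andP; split => //; lra].
  have zTE : z.2 = T by apply/eqP; rewrite eq_le zT' Tz.
  have [] := @not_blow_up_bounded z.1 (Er _ zE).
    by move=> /only0 z10; move: E0; rewrite -zE z10 sqdistxx ltxx.
  move=> K; rewrite -zTE -surjective_pairing => hK; exists K.
  move: hK; apply: filterS => z' h [z'E /andP[Tz' _]] z'T.
  apply: h; [exact: Er|rewrite zTE; lra].
move/compact_near_coveringP/near_covering_withinP : cC.
move=> /(_ R +oo (fun K z => z.2 < T -> u z.1 z.2 <= K) _) => h.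
have {}h : \forall K \near +oo, C `<=` (fun z => z.2 < T -> u z.1 z.2 <= K).
  apply: h => z /locb[K hK].
  (* Any bound above K serves on the same neighbourhood. *)
  exists ([set z' | C z' -> z'.2 < T -> u z'.1 z'.2 <= K], [set K' | K <= K']).
    by split; [exact: hK|exact: nbhs_pinfty_ge (num_real K)].
  move=> [z' K'] /= [h1 h2] Cz' /(h1 Cz'); move/le_trans; exact.
have [K hK] := filter_ex h.
exists K => x t xE /andP[Tt tT]; apply: (hK (x, t)) => //.
by split => //=; rewrite Tt ltW.
Qed.

(** * The blow-up rate *)

(** Comparison of u(x,t+h) with w = u + k exp(p u), where k = c exp(-p K) h. The choice
of [k] makes w <= u(x,t+h) wherever u <= K; in particular on the bottom and on
the lateral boundary, and a point violating it has u > K >= 1.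
There w is a subsolution, by [reaction_growth] and because the gradient term
k p^2 exp(p u) |grad u|^2 has the favourable sign. *)
Lemma increment_ge_expR (c K E : R) : 0 < c -> 0 < E -> 1 <= K ->
  (forall x : 'rV[R]_n, sqdist x 0 <= E -> eball r x) ->
  (forall (x : 'rV[R]_n) (t h : R), 0 <= h -> T / 2 <= t -> t + h < T ->
    sqdist x 0 <= E -> c * h <= u x (t + h) - u x t) ->
  (forall (x : 'rV[R]_n) t, sqdist x 0 = E -> T / 2 <= t < T -> u x t <= K) ->
  (forall x : 'rV[R]_n, sqdist x 0 <= E -> u x (T / 2) <= K) ->
  forall t h : R, 0 <= h -> T / 2 <= t -> t + h < T ->
    c * expR (- (p * K)) * h * expR (p * u 0 t) <= u 0 (t + h) - u 0 t.
Proof.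
move=> c0 E0 K1 Er growth lat ini t h h0 Tt thT.
pose k := c * expR (- (p * K)) * h.
have k0 : 0 <= k by rewrite !mulr_ge0 ?expR_ge0// ltW.
have p0 : 0 < p := lt_trans ltr01 p1.
pose F (b : R) := expR (p * b).
pose F1 (b : R) := p * F b.
pose F2 (b : R) := p * F1 b.
have dF (b : R) : is_derive b 1 F (F1 b).
  have : is_derive b 1 (expR \o (p \*: id)) (expR (p * b) * (p * 1)).
    by apply: is_derive1_comp.
  by move=> ?; apply: is_derive_eq; rewrite mulr1 mulrC.
have dF1 (b : R) : is_derive b 1 F1 (F2 b).
  have : is_derive b 1 (p \*: F) (p *: F1 b) by apply: is_deriveZ; exact: dF.
  by [].
have F0 b : 0 < F b by exact: expR_gt0.
rewrite -/k -subr_ge0.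
have cy : continuous (fun _ : R => 0 : 'rV[R]_n) by exact: cst_continuous.
have sub (z : 'rV[R]_n * R) : tube (fun=> 0) E (T / 2) t z -> ecball r z.1.
  by move=> [_ zE]; apply: ball_subset; exact: Er zE.
have cu : {within tube (fun=> 0) E (T / 2) t, continuous (fun z => u z.1 z.2)}.
  apply: sol_continuous0 => z zt; split; first exact: sub.
  by case: zt => /= ? _; lra.
have cFu : {within tube (fun=> 0) E (T / 2) t,
    continuous (fun z => k * F (u z.1 z.2))}.
  move=> z; apply: cvgM; first exact: cvg_cst.
  apply: (@continuous_comp _ _ _ _ F); first exact: cu.
  by apply: continuous_comp; [exact: mulrl_continuous|exact: continuous_expR].
have [B [B0 HB]] := @compact_within_bounded _ _ _
  (fun z => u z.1 z.2 + k * F (u z.1 z.2)) (compact_tube r0 cy sub)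
  (fun z => cvgD (cu z) (cFu z)).
have [L [L0 HL]] := reaction_lipschitz p1 B.
(* Here the lower bound c h of the increment is enough. *)
have low x s : T / 2 <= s <= t -> sqdist x 0 <= E -> u x s <= K ->
    0 <= u x (s + h) - u x s - k * F (u x s).
  move=> st xE uK; rewrite subr_ge0.
  apply: (@le_trans _ _ (c * h)); last by apply: growth => //; lra.
  have : F (u x s) <= expR (p * K) by rewrite ler_expR ler_pM2l.
  move=> /(ler_wpM2l k0)/le_trans; apply.
  have -> : k * expR (p * K) = c * h * (expR (- (p * K)) * expR (p * K)).
    by rewrite /k; ring.
  by rewrite -expRD addNr expR0 mulr1.
apply: (@tube_minimum_principle _ _ (fun=> 0) E (T / 2) t r
  (fun x s => u x (s + h) - u x s - k * F (u x s)) L r0 cy sub) => //.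
- apply: within_continuousB cFu; apply: within_continuousB cu.
  apply: sol_continuous => z zt; split; first exact: sub.
  by case: zt => /= ? _; lra.
- by move=> x xE; apply: low; [lra|exact: xE|exact: ini].
- move=> x s st xE; apply: low; [lra|by rewrite xE|].
  by apply: lat => //; lra.
- move=> x s st xE dneg.
  have xr : eball r x by apply: Er; exact: ltW.
  have xr' := ball_subset xr.
  have sT : 0 < s < T by lra.
  have shT : 0 < s + h < T by lra.
  have uK : K < u x s.
    rewrite ltNge; apply/negP => uK.
    by move: dneg; rewrite ltNge low//; lra.
  have dFu : is_derive s 1 (F \o u x) (F1 (u x s) *
      (laplacian (u ^~ s) x + reaction p (u x s))).
    exact: is_derive_comp_dir (dF _) (sol_derivative xr sT).
  exists ((laplacian (u ^~ (s + h)) x + reaction p (u x (s + h))) -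
     (laplacian (u ^~ s) x + reaction p (u x s)) -
     k * (F1 (u x s) * (laplacian (u ^~ s) x + reaction p (u x s)))).
  exists (laplacian (u ^~ (s + h)) x - laplacian (u ^~ s) x -
     k * (F1 (u x s) * laplacian (u ^~ s) x +
       F2 (u x s) * \sum_i partial i (u ^~ s) x ^+ 2)).
  split.
  + apply: is_deriveB.
      by apply: is_deriveB; [exact: sol_shift_derivative|exact: sol_derivative].
  + apply: is_laplacianB.
      by apply: is_laplacianB; exact: sol_laplacian.
    apply: is_laplacianZ.
    exact: is_laplacian_comp dF dF1 (sol_laplacian xr sT).
  + have v0 : 0 <= u x (s + h) by apply: (cs_ge0 sol) => //; lra.
    have kF : 0 <= k * F (u x s) by rewrite mulr_ge0// ltW.
    have wB : u x s + k * F (u x s) <= B.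
      by apply: (HB (x, s)); split => /=; [lra|exact: ltW].
    have vw : u x (s + h) <= u x s + k * F (u x s) by lra.
    have h1 := HL _ _ v0 vw wB.
    have uw : u x s <= u x s + k * F (u x s) by rewrite lerDl.
    have h2 := reaction_growth p1 (le_trans K1 (ltW uK)) uw.
    have h3 : 0 <= k * (F2 (u x s) * \sum_i partial i (u ^~ s) x ^+ 2).
      rewrite mulr_ge0// mulr_ge0//; last by apply: sumr_ge0 => i _; exact: sqr_ge0.
      by rewrite /F2 /F1 !mulr_ge0// ltW.
    move: h1 h2 h3; rewrite /F1 (addrC (u x s)) addrK (_ : L * (u x (s + h) -
      (k * F (u x s) + u x s)) = L * (u x (s + h) - u x s - k * F (u x s))); last by ring.
    move: (F2 (u x s) * _) (L * _) => G l.
    move: (laplacian (u ^~ (s + h)) x) (laplacian (u ^~ s) x) => l2 l1.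
    move: (reaction p (u x (s + h))) (reaction p (u x s))
      (reaction p (k * F (u x s) + u x s)) => f2 f1 fw.
    move: (F (u x s)) => X h1 h2 h3.
    rewrite [leRHS](_ : _ = (f2 - fw) + (fw - f1 - p * f1 * (k * X)) + k * G); last by ring.
    lra.
- by rewrite Tt lexx.
- by rewrite sqdistxx ltW.
Qed.

(** For t < T/2 monotonicity in time gives the bound at the price of a factor 2, as
T - t <= 2 (T - T/2). *)
Lemma log_blow_up_rate : (forall x, blow_up_point r T u x <-> x = 0) ->
  exists C : R, 0 < C /\
    forall t, 0 < t < T -> u 0 t <= ln C - p^-1 * ln (T - t).
Proof.
move=> only0.
have p0 : 0 < p := lt_trans ltr01 p1.
have [x0 [x0r res0]] := strict_residual ((only0 0).2 erefl).
have [k [k0 nk]] := residual_near x0r res0.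
have [S1 [S10 HS1]] := shrink_center r0 x0r.
have [S2 [S20 HS2]] := near_sqdist nk.
pose S := Num.min S1 S2.
have S0 : 0 < S by rewrite lt_min S10.
have SS1 : S <= S1 by rewrite ge_min lexx.
have SS2 : S <= S2 by rewrite ge_min lexx orbT.
have [c [c0 growth]] : exists c, 0 < c /\ forall x t, 0 <= t < T ->
    sqdist x x0 <= S -> g x + c * t * (S - sqdist x x0) <= u x t.
  by apply: (initial_growth S0 k0) => x xS; apply: HS2; exact: le_trans xS SS2.
have inball s x : 0 <= s <= 1 -> sqdist x (s *: x0) <= S -> eball r x.
  by move=> s01 xS; apply: (HS1 s) => //; exact: le_trans xS SS1.
have [c1 [c10 unif]] := increment_lower_bound S0 c0 inball growth.
pose E := S / 2.
have E0 : 0 < E by rewrite divr_gt0.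
have Er (x : 'rV[R]_n) : sqdist x 0 <= E -> eball r x.
  move=> xE; apply: (inball 0); first by rewrite lexx ler01.
  by rewrite scale0r; apply: le_trans xE _; rewrite /E; lra.
have [K1 HK1] : exists K : R, forall (x : 'rV[R]_n) t, sqdist x 0 = E ->
    T / 2 <= t < T -> u x t <= K.
  apply: sphere_bound => //; first by move=> x /only0.
  by move=> x xE; apply: ball_subset; apply: Er; rewrite xE.
have T2 : 0 <= T / 2 < T by have := T0; lra.
have sub (z : 'rV[R]_n * R) : cylinder r 0 (T / 2) z -> ecball r z.1.
  by move=> /(cylinderP r0)[].
have cy : continuous (fun _ : R => 0 : 'rV[R]_n) by exact: cst_continuous.
have [K2 [K20 HK2]] := compact_within_bounded (compact_tube r0 cy sub)
  (sol_continuous0 (fun z => cylinder_domain (z := z) (proj2 (andP T2)))).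
pose K := 1 + `|K1| + K2.
have K_1 : 1 <= K by rewrite /K; have := normr_ge0 K1; lra.
have KK1 : K1 <= K by rewrite /K; have := ler_norm K1; lra.
have KK2 : K2 <= K by rewrite /K; have := normr_ge0 K1; lra.
have incr := increment_ge_expR c10 E0 K_1 Er unif.
have {}incr := incr (fun x t xE tT => le_trans (HK1 x t xE tT) KK1).
have low (x : 'rV[R]_n) : ecball r x -> u x (T / 2) <= K.
  move=> xr; apply: le_trans KK2; apply: (HK2 (x, T / 2)).
  by apply/(cylinderP r0); split => //=; rewrite lexx andbT; case/andP: T2.
have {}incr := incr (fun x xE => low x (ball_subset (Er x xE))).
pose d := c1 * expR (- (p * K)).
have d0 : 0 < d by rewrite mulr_gt0// expR_gt0.
have o_in : eball r (0 : 'rV[R]_n) by apply: Er; rewrite sqdistxx ltW.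
have rate t : T / 2 <= t < T -> p * d * (T - t) <= expR (- (p * u 0 t)).
  apply: (@blow_up_rate _ (u 0) (derive1 (u 0))) => // s sT.
  have [|ds _] := cs_C1 sol o_in (t := s); first by move: T2; lra.
  by rewrite derive1E; exact: derivableP.
have pd : 0 < p * d / 2 by rewrite divr_gt0// mulr_gt0.
have rate' t : 0 < t < T -> p * d / 2 * (T - t) <= expR (- (p * u 0 t)).
  move=> tT; have [Tt|tT2] := leP (T / 2) t.
    apply: le_trans (rate t _); last by rewrite Tt; case/andP: tT.
    by rewrite ler_wpM2r ?subr_ge0; move: tT pd; lra.
  apply: (@le_trans _ _ (p * d * (T - T / 2))).
    have -> : p * d * (T - T / 2) = p * d / 2 * T by field.
    by rewrite ler_pM2l//; move: tT; lra.
  apply: le_trans (rate (T / 2) _) _; first by rewrite lexx; case/andP: T2.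
  rewrite ler_expR lerN2 ler_pM2l//.
  have -> : T / 2 = t + (T / 2 - t) by ring.
  by apply: sol_nondecreasing; [exact: ball_subset|move: tT tT2; lra..].
exists (expR (- (p^-1 * ln (p * d / 2)))); split; first exact: expR_gt0.
move=> t tT; have Tt : 0 < T - t by move: tT; lra.
rewrite expRK -opprD -mulrDr -lnM ?posrE//.
have := rate' t tT; rewrite -ler_ln ?posrE ?mulr_gt0 ?expR_gt0// expRK => h.
rewrite -(ler_pM2l p0) mulrN mulrA mulfV ?gt_eqF// mul1r.
by rewrite lerNr.
Qed.

End Solution.

Theorem theorem2p4 (R : realType) (n : nat) (hn : (1 <= n)%N)
  (r p T : R) (hr : 0 < r) (hp : 1 < p) (hT : 0 < T)
  (u0 : 'rV[R]_n -> R)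
  (u0_smooth : smooth_on (ecball r) u0)
  (u0_neq0 : exists x, ecball r x /\ u0 x <> 0)
  (u0_ge0 : forall x, ecball r x -> 0 <= u0 x)
  (u0_radial : radially_symmetric (ecball r) u0)
  (u0_nonincr : radially_nonincreasing (ecball r) u0)
  (u0_boundary : forall x, esphere r x -> u0 x = 0)
  (u0_sub : forall x, eball r x -> 0 <= laplacian u0 x + expR (u0 x `^ p))
  (u : 'rV[R]_n -> R -> R)
  (u_sol : classical_solution r p T u0 u)
  (u_blowup : blows_up_at r T u)
  (u_blowup_point : forall x, blow_up_point r T u x <-> x = 0) :
  exists C : R, 0 < C /\
    forall t, 0 < t < T -> u 0 t <= ln C - p^-1 * ln (T - t).
Proof.
have [g [gC gu0]] := u0_smooth.
apply: (@log_blow_up_rate R n r p T u0 u hr hp hT u_sol g (gC 2)) => //.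
- by move=> x xr; rewrite gu0//; exact: u0_ge0.
- by move=> x xr; rewrite gu0 ?u0_boundary//; exact: sphere_subset.
- by move=> x xr; rewrite (cs_initial u_sol xr) gu0//; exact: ball_subset.
- move=> x xr; rewrite /reaction (gu0 x (ball_subset xr)).
  suff <- : laplacian u0 x = laplacian g x by exact: u0_sub.
  have near_g : {near x, g =1 u0}.
    by apply: filterS (near_eball hr xr) => y /ball_subset; exact: gu0.
  exact: (is_laplacian_ext near_g (g_laplacian (gC 2) x)).2.
Qed.
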